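(* Let $V$ be a compact connected Riemann surface with boundary $dV\ne\emptyset$. Suppose $f:V\to\mathbb P^n$ is a holomorphic map which extends holomorphically across the boundary. Then $$f(V)\subseteq\widehat{f(dV)}.$$
   Context: Sections of $\mathcal O(d)$ over $\mathbb P^n$ are identified with homogeneous polynomials $P$ of degree $d$ on $\mathbb C^{n+1}$, with norm $\|\mathcal P([Z])\|=|P(Z)|/\|Z\|^d$. The projective hull $\widehat K$ of a compact set $K\subset\mathbb P^n$ is the set of $x\in\mathbb P^n$ for which there is a constant $C=C_x>0$ with $\|\mathcal P(x)\|\le C^d\sup_K\|\mathcal P\|$ for all $\mathcal P\in H^0(\mathbb P^n,\mathcal O(d))$ and all $d>0$. ''Extends holomorphically across the boundary'' means that $V\subset\subset\widetilde V$ for some connected non-compact Riemann surface $\widetilde V$ to which $f$ extends as a holomorphic map into $\mathbb P^n$. *)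

(* Defs.v *)
From HB Require Import structures.
From mathcomp Require Import all_boot all_order all_algebra.
From mathcomp Require Import generic_quotient complex.
(* The notations of mpoly clash with those of MathComp-Analysis. *)
From mathcomp Require Import -(notations) mpoly.
From mathcomp Require Import all_classical all_reals all_analysis.

Set Implicit Arguments.
Unset Strict Implicit.
Unset Printing Implicit Defensive.

Import Order.TTheory GRing.Theory Num.Theory.
Import numFieldNormedType.Exports.
Local Open Scope classical_set_scope.
Local Open Scope ring_scope.
Local Open Scope quotient_scope.

(* A named alias, so that [R[i]] inherits the topology that MathComp-Analysis
   puts on every [numClosedFieldType]. *)
Definition Cplx (R : realType) : numClosedFieldType := R[i].

Definition modc (R : realType) (z : Cplx R) : R := ComplexField.Normc.normc z.
Definition imc (R : realType) (z : Cplx R) : R := complex.Im (z : R[i]).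

Section ProjectiveSpace.
Variables (R : realType) (n : nat).
Local Notation C := (Cplx R).

Definition nonzero_vectors : set 'rV[C]_n.+1 := [set Z | Z != 0].

Definition same_line (Z W : nonzero_vectors) : bool :=
  `[< exists2 a : C, a != 0 & \val W = a *: \val Z >].

Lemma same_line_refl : reflexive same_line.
Proof. by move=> Z; apply/asboolP; exists 1; rewrite ?oner_neq0 ?scale1r. Qed.

Lemma same_line_sym : ssrbool.symmetric same_line.
Proof.
have H Z W : same_line Z W -> same_line W Z.
  move=> /asboolP[a a0 e]; apply/asboolP; exists a^-1; first by rewrite invr_eq0.
  by rewrite e scalerA mulVf // scale1r.
by move=> Z W; apply/idP/idP; exact: H.
Qed.

Lemma same_line_trans : transitive same_line.
Proof.
move=> Y X Z /asboolP[a a0 ea] /asboolP[b b0 eb]; apply/asboolP.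
by exists (b * a); rewrite ?mulf_neq0 // eb ea scalerA.
Qed.

Definition line_equiv := EquivRel _ same_line_refl same_line_sym same_line_trans.

Definition proj_space := {eq_quot line_equiv}.

HB.instance Definition _ :=
  Topological.copy proj_space (quotient_topology proj_space).
HB.instance Definition _ := Quotient.on proj_space.

Definition homog_coord (x : proj_space) : 'rV[C]_n.+1 := \val (repr x).

Lemma homog_coord_neq0 x : homog_coord x != 0.
Proof. by rewrite /homog_coord; case: (repr x) => Z /= /set_mem. Qed.

Lemma homog_coord_pi (Z : nonzero_vectors) :
  exists2 a : C, a != 0 & homog_coord (\pi_proj_space Z) = a *: \val Z.
Proof.
have : same_line Z (repr (\pi_proj_space Z)).
  by rewrite -[same_line _ _]/(line_equiv _ _) -eqmodE reprK.
by move=> /asboolP.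
Qed.

Definition affine_open (i : 'I_n.+1) : set proj_space :=
  [set x | homog_coord x 0 i != 0].

Definition affine_coord (i j : 'I_n.+1) (x : proj_space) : C :=
  homog_coord x 0 j / homog_coord x 0 i.

Definition hnorm (Z : 'rV[C]_n.+1) : R :=
  Num.sqrt (\sum_(i < n.+1) modc (Z 0 i) ^+ 2).

Definition hpoly_eval (P : mpoly n.+1 C) (Z : 'rV[C]_n.+1) : C :=
  meval (fun i => Z 0 i) P.

(* The norm of the section of O(d) given by a homogeneous [P] of degree [d];
   it does not depend on the homogeneous coordinates, by [section_norm_pi]. *)
Definition section_norm (d : nat) (P : mpoly n.+1 C) (x : proj_space) : R :=
  modc (hpoly_eval P (homog_coord x)) / hnorm (homog_coord x) ^+ d.

Lemma modcM (z w : C) : modc (z * w) = modc z * modc w.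
Proof. exact: ComplexField.Normc.normcM. Qed.

Lemma modcX (z : C) d : modc (z ^+ d) = modc z ^+ d.
Proof.
elim: d => [|d IH]; last by rewrite !exprS modcM IH.
by rewrite !expr0 /modc ComplexField.Normc.normc1.
Qed.

Lemma hpoly_evalZ d (P : mpoly n.+1 C) (a : C) Z :
  P \is ishomog1 d (@mdeg _) -> hpoly_eval P (a *: Z) = a ^+ d * hpoly_eval P Z.
Proof.
move=> /dhomogP hP; rewrite /hpoly_eval !mevalE mulr_sumr big_seq [RHS]big_seq.
apply: eq_bigr => m /hP hm; have {hm}<- : mdeg m = d := hm.
rewrite mulrCA; congr (_ * _); rewrite mdegE -prodrXr -big_split /=; apply: eq_bigr => i _.
by rewrite mxE exprMn.
Qed.

Lemma hnormZ (a : C) Z : hnorm (a *: Z) = modc a * hnorm Z.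
Proof.
have a0 : 0 <= modc a by case: a => x y; exact: sqrtr_ge0.
rewrite /hnorm; under eq_bigr do rewrite mxE modcM exprMn.
by rewrite -mulr_sumr sqrtrM ?sqr_ge0 // sqrtr_sqr ger0_norm.
Qed.

Lemma section_norm_pi d (P : mpoly n.+1 C) (Z : nonzero_vectors) :
  P \is ishomog1 d (@mdeg _) ->
  section_norm d P (\pi_proj_space Z) =
  modc (hpoly_eval P (\val Z)) / hnorm (\val Z) ^+ d.
Proof.
move=> hP; have [a a0 e] := homog_coord_pi Z.
rewrite /section_norm e (hpoly_evalZ _ _ hP) hnormZ modcM modcX exprMn.
have ma0 : modc a != 0.
  by apply: contra a0 => /eqP/ComplexField.Normc.eq0_normc ->.
by rewrite invfM mulrACA divff ?mul1r // expf_neq0.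
Qed.

(* [sup] is the supremum in [R]; the values are bounded for every [K]. For
   [K = set0] it is [0], and the hull is then empty. *)
Definition projective_hull (K : set proj_space) : set proj_space :=
  [set x | exists2 c : R, 0 < c &
    forall (d : nat) (P : mpoly n.+1 C), (0 < d)%N ->
      P \is ishomog1 d (@mdeg _) ->
      section_norm d P x <= c ^+ d * sup (section_norm d P @` K)].

End ProjectiveSpace.

Arguments affine_open {R n} i.

(* Complex derivative relative to [A]. When [A] is open this is the ordinary
   complex derivative; at a boundary point of a half plane it is the one-sided
   one, so a map that is smooth up to the boundary and holomorphic inside has
   it everywhere. *)
Definition cderive_within (R : realType) (A : set (Cplx R))
    (g : Cplx R -> Cplx R) (z l : Cplx R) : Prop :=
  (fun w => (g w - g z) / (w - z)) @ within A z^' --> l.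

Definition holomorphic_on (R : realType) (A : set (Cplx R))
    (g : Cplx R -> Cplx R) : Prop :=
  forall z, A z -> exists l, cderive_within A g z l.

Definition closed_upper_half_plane (R : realType) : set (Cplx R) :=
  [set z | 0 <= imc z].

(* A homeomorphism from an open subset of [T] onto a relatively open subset of
   the model [M]; [chart_map] and [chart_inv] are only meaningful on
   [chart_dom] and [chart_cod]. *)
Record chart (R : realType) (M : set (Cplx R)) (T : topologicalType) := Chart {
  chart_dom : set T;
  chart_cod : set (Cplx R);
  chart_map : T -> Cplx R;
  chart_inv : Cplx R -> T;
  chart_dom_open : open chart_dom;
  chart_cod_open : exists2 O, open O & chart_cod = O `&` M;
  chart_map_fun : set_fun chart_dom chart_cod chart_map;
  chart_inv_fun : set_fun chart_cod chart_dom chart_inv;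
  chart_mapK : {in chart_dom, cancel chart_map chart_inv};
  chart_invK : {in chart_cod, cancel chart_inv chart_map};
  chart_map_continuous : {within chart_dom, continuous chart_map};
  chart_inv_continuous : {within chart_cod, continuous chart_inv}
}.

Record surface (R : realType) (M : set (Cplx R)) := Surface {
  surface_space :> topologicalType;
  surface_hausdorff : hausdorff_space surface_space;
  surface_atlas : set (chart M surface_space);
  surface_cover : forall p, exists2 c, surface_atlas c & chart_dom c p;
  surface_compatible : forall c c', surface_atlas c -> surface_atlas c' ->
    holomorphic_on (chart_map c @` (chart_dom c `&` chart_dom c'))
      (chart_map c' \o chart_inv c)
}.

Definition riemann_surface (R : realType) := surface (@setT (Cplx R)).

Definition bordered_riemann_surface (R : realType) :=
  surface (@closed_upper_half_plane R).

Definition surface_boundary (R : realType) (V : bordered_riemann_surface R) : set V :=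
  [set p | exists c, [/\ surface_atlas (s := V) c, chart_dom c p &
                         imc (chart_map c p) = 0]].
Arguments surface_boundary {R} V.

(* Holomorphy into P^n is tested in the affine charts [Z_i != 0]. *)
Definition holomorphic_to_proj (R : realType) (n : nat) (M : set (Cplx R))
    (X : surface M) (f : X -> proj_space R n) : Prop :=
  continuous f /\
  forall (c : chart M X) (i j : 'I_n.+1), surface_atlas c ->
    holomorphic_on (chart_map c @` (chart_dom c `&` f @^-1` affine_open i))
      (affine_coord i j \o f \o chart_inv c).

(* Injective holomorphic immersions. On a compact [X] these are embeddings,
   surfaces being Hausdorff. *)
Definition holomorphic_embedding (R : realType) (M N : set (Cplx R))
    (X : surface M) (Y : surface N) (h : X -> Y) : Prop :=
  [/\ injective h, continuous h &
   forall (c : chart M X) (c' : chart N Y),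
     surface_atlas c -> surface_atlas c' ->
     let A := chart_map c @` (chart_dom c `&` h @^-1` chart_dom c') in
     forall z, A z -> exists2 l, l != 0 &
       cderive_within A (chart_map c' \o h \o chart_inv c) z l].

Definition extends_across_boundary (R : realType) (n : nat)
    (V : bordered_riemann_surface R) (f : V -> proj_space R n) : Prop :=
  exists (W : riemann_surface R) (h : V -> W) (g : W -> proj_space R n),
    [/\ connected [set: W], ~ compact [set: W],
        holomorphic_embedding h, precompact (range h) &
        holomorphic_to_proj g /\ f = g \o h].

(* Main.v *)
Require Import Defs.
From mathcomp Require Import all_boot all_order all_algebra.
From mathcomp Require Import generic_quotient complex.
From mathcomp Require Import -(notations) mpoly.
From mathcomp Require Import all_classical all_reals all_analysis.
From mathcomp Require Import ring lra.

(** Write [M] for the supremum of the norm of the section [P o f] over [V] and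
    [S] for its supremum over the boundary. It has to be shown that
    [M <= K ^ d * S] with a constant [K] that depends neither on [P] nor on its
    degree [d]. It is enough to find [N] and [K] such that, at every point [q],

      [norm (P (f q)) ^ (N + 1) <= K ^ d * M ^ N * S]:

    the supremum over [q] gives [M ^ (N + 1) <= K ^ d * M ^ N * S], and [M ^ N]
    cancels ([le_of_sup_interpolation]). This weak form of a two-constants
    inequality can be propagated through [V] from chart to chart, with local
    lifts of [f] only.

    Around a point, [f] lifts to a holomorphic vector [F] with [1 <= |F| <= L]
    on a disc, or on a half disc in the closed upper half plane. There the norm
    of the section is [|P(F)|] up to the harmless factor [L ^ d], and [P(F)] is
    a holomorphic function ([local_section]). Two estimates for holomorphic
    functions do the rest.
    - Near the boundary, the square with centre [z] and half side [Im z] has its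
      bottom side on the real line. If [|g| <= M] on a square and [|g| <= S] on
      one side, then [|g|^4 <= S * M^3] at the centre, because the product of
      the four rotated copies of [g] is at most [S * M^3] on the whole perimeter
      ([center_le_bottom]).
    - In the interior, a small disc on which the inequality is known is enlarged
      by the three circles theorem ([three_circles]).
    Thus the set of points near which the inequality holds for some [N] and [K]
    is open, nonempty and closed ([good_closed]), hence all of [V], and the
    compactness of [V] makes [N] and [K] uniform.

    Both estimates rest on the maximum modulus principle for functions that are
    only assumed to have a complex derivative at each point. It is obtained from
    Goursat's bisection argument, with recursively refined trapezoid sums in the
    place of contour integrals: they are exactly additive under bisection, they
    vanish on affine functions, and no integral has to be defined. Applied to
    the difference quotient [(g z - g c) / (z - c)] on a square with centre [c]
    ([goursat]), this bounds [|g c|] by twice the maximum of [|g|] on the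
    perimeter, and the factor 2 disappears when the bound is applied to the
    powers of [g] ([center_le_perimeter]). *)

Set Implicit Arguments.
Unset Strict Implicit.
Unset Printing Implicit Defensive.

Import Order.TTheory GRing.Theory Num.Theory.
Import numFieldNormedType.Exports.
Local Open Scope ring_scope.
Local Open Scope quotient_scope.
Local Open Scope classical_set_scope.

(** * Complex numbers by real and imaginary part *)

Section Modulus.
Variable R : realType.
Local Notation C := (Cplx R).
Implicit Types z w : C.

Definition rec (z : C) : R := complex.Re (z : R[i]).
Definition cmk (x y : R) : C := Complex x y.

Lemma modcE z : modc z = Num.sqrt (rec z ^+ 2 + imc z ^+ 2).
Proof. by case: z. Qed.

Lemma modc_ge0 z : 0 <= modc z.
Proof. by rewrite modcE sqrtr_ge0. Qed.

Lemma modc0 : modc (0 : C) = 0.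
Proof. exact: ComplexField.Normc.normc0. Qed.

Lemma modc1 : modc (1 : C) = 1.
Proof. exact: ComplexField.Normc.normc1. Qed.

Lemma modcN z : modc (- z) = modc z.
Proof. exact: normcN. Qed.

Lemma modcB z w : modc (z - w) = modc (w - z).
Proof. by rewrite -modcN opprB. Qed.

Lemma modcD z w : modc (z + w) <= modc z + modc w.
Proof. exact: le_normcD. Qed.

Lemma modcV z : modc z^-1 = (modc z)^-1.
Proof. exact: ComplexField.Normc.normcV. Qed.

Lemma modc_eq0 z : (modc z == 0) = (z == 0).
Proof.
apply/eqP/eqP => [/ComplexField.Normc.eq0_normc //|->]; exact: modc0.
Qed.

Lemma modc_gt0 z : (0 < modc z) = (z != 0).
Proof. by rewrite lt0r modc_ge0 modc_eq0 andbT. Qed.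

Lemma norm_modc z : `|z| = (modc z)%:C%C :> C.
Proof. by case: z => x y; rewrite normc_def. Qed.

Lemma recD z w : rec (z + w) = rec z + rec w.
Proof. by case: z; case: w. Qed.
Lemma imcD z w : imc (z + w) = imc z + imc w.
Proof. by case: z; case: w. Qed.
Lemma recN z : rec (- z) = - rec z.
Proof. by case: z. Qed.
Lemma imcN z : imc (- z) = - imc z.
Proof. by case: z. Qed.
Lemma recM z w : rec (z * w) = rec z * rec w - imc z * imc w.
Proof. by case: z; case: w. Qed.
Lemma imcM z w : imc (z * w) = rec z * imc w + imc z * rec w.
Proof. by case: z => a b; case: w => c d. Qed.

Lemma rec_cmk x y : rec (cmk x y) = x. Proof. by []. Qed.
Lemma imc_cmk x y : imc (cmk x y) = y. Proof. by []. Qed.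

Lemma cplx_ext z w : rec z = rec w -> imc z = imc w -> z = w.
Proof. by case: z => a b; case: w => c d /= -> ->. Qed.

Lemma rec_le_modc z : `|rec z| <= modc z.
Proof. by rewrite modcE -sqrtr_sqr ler_wsqrtr // lerDl sqr_ge0. Qed.

Lemma imc_le_modc z : `|imc z| <= modc z.
Proof. by rewrite modcE -sqrtr_sqr ler_wsqrtr // lerDr sqr_ge0. Qed.

Lemma modc_le_recim z : modc z <= `|rec z| + `|imc z|.
Proof.
rewrite modcE -[leRHS]ger0_norm ?addr_ge0 // -sqrtr_sqr ler_wsqrtr //.
rewrite sqrrD !real_normK ?num_real // addrAC lerDl.
by rewrite mulrn_wge0 // mulr_ge0.
Qed.

Lemma nbhs_modcP z (A : set C) :
  nbhs z A <-> exists2 e : R, 0 < e & forall w, modc (w - z) < e -> A w.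
Proof.
split=> [/nbhs_normP[e /= e0 He]|[e e0 He]].
  have [eI eR] : complex.Im (e : R[i]) = 0 /\ 0 < complex.Re (e : R[i]).
    by move: e0; rewrite /= ltcE /= => /andP[/eqP-> ->].
  exists (complex.Re (e : R[i])) => // w hw; apply: He => /=.
  rewrite distrC norm_modc.
  by case: e e0 eI eR hw => a b /= _ -> _ hw; rewrite ltcE /= eqxx.
apply/nbhs_normP; exists (e%:C%C : C) => /=; first by rewrite ltcE /= eqxx.
by move=> w /= hw; apply: He; move: hw; rewrite distrC norm_modc ltcE /= eqxx.
Qed.

Lemma cderive_withinP (A : set C) g z l : cderive_within A g z l <->
  forall e : R, 0 < e -> exists2 d : R, 0 < d &
    forall w, A w -> w != z -> modc (w - z) < d ->
      modc ((g w - g z) / (w - z) - l) < e.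
Proof.
split=> [H e e0|H].
  have /H : nbhs l [set v | modc (v - l) < e] by apply/nbhs_modcP; exists e.
  rewrite /= /fmap /within /= => /nbhs_modcP[d d0 hd].
  by exists d => // w Aw wz wd; apply: hd.
move=> B /nbhs_modcP[e e0 he]; have [d d0 hd] := H _ e0.
by apply/nbhs_modcP; exists d => // w wd wz Aw; apply: he; apply: hd.
Qed.

(** The product and inverse rules use this relative continuity. *)
Lemma cderive_within_cvg (A : set C) g z l :
  cderive_within A g z l -> g @ within A z^' --> g z.
Proof.
move=> /cderive_withinP H B /nbhs_modcP[e e0 he].
have [d d0 hd] := H _ ltr01.
have B0 : 0 < modc l + 1 by rewrite ltr_wpDl ?modc_ge0.
apply/nbhs_modcP; exists (Num.min d (e / (modc l + 1))).
  by rewrite lt_min d0 divr_gt0.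
move=> w; rewrite lt_min => /andP[wd we] wz Aw /=; apply: he.
have wz0 : w - z != 0 by rewrite subr_eq0.
rewrite -[g w - g z](divfK wz0) modcM.
apply: le_lt_trans (_ : (modc l + 1) * modc (w - z) < e); last first.
  by rewrite mulrC -ltr_pdivlMr.
rewrite ler_wpM2r ?modc_ge0 //.
have := modcD ((g w - g z) / (w - z) - l) l; rewrite subrK.
move/le_trans; apply; rewrite addrC lerD2l; exact/ltW/hd.
Qed.

End Modulus.

(** * Rules for relative holomorphy *)

Section Holomorphic.
Variable R : realType.
Local Notation C := (Cplx R).
Implicit Types (A B : set C) (f g : C -> C).

Lemma holo_sub A B g : B `<=` A -> holomorphic_on A g -> holomorphic_on B g.
Proof.
move=> BA hg z Bz; have [l hl] := hg z (BA _ Bz); exists l.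
apply/cderive_withinP => e e0; have /cderive_withinP/(_ _ e0)[d d0 hd] := hl.
by exists d => // w /BA; exact: hd.
Qed.

Lemma holo_ext A f g : {in A, f =1 g} -> holomorphic_on A f ->
  holomorphic_on A g.
Proof.
move=> fg hf z Az; have [l /cderive_withinP hl] := hf z Az; exists l.
apply/cderive_withinP => e e0; have [d d0 hd] := hl _ e0; exists d => // w Aw.
by rewrite -!fg ?inE //; exact: hd.
Qed.

Lemma holo_near A g z (e : R) : holomorphic_on A g -> A z -> 0 < e ->
  exists2 d : R, 0 < d &
    forall w, A w -> modc (w - z) < d -> modc (g w - g z) < e.
Proof.
move=> hg Az e0; have [l /cderive_within_cvg hl] := hg z Az.
have /hl : nbhs (g z) [set v | modc (v - g z) < e] by apply/nbhs_modcP; exists e.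
move=> /nbhs_modcP[d d0 hd]; exists d => // w Aw wd.
by have [->|wz] := eqVneq w z; [rewrite subrr modc0|exact: hd].
Qed.

(** Differentiation rules compare a limit given by the calculus of limits with
    the difference quotient, which is only meaningful for [w != z] in [A]. *)
Lemma cderive_within_eq A g z (q : C -> C) (l : C) :
  q @ within A z^' --> l ->
  (forall w, A w -> w - z != 0 -> q w = (g w - g z) / (w - z)) ->
  cderive_within A g z l.
Proof.
move=> hq E; apply: cvg_trans hq; apply: near_eq_cvg.
by apply/nbhs_modcP; exists 1 => // w _ wz Aw; rewrite E // subr_eq0.
Qed.

Lemma holo_cst A (a : C) : holomorphic_on A (fun=> a).
Proof.
move=> z _; exists 0; apply/cderive_withinP => e e0; exists 1 => // w _ _ _.
by rewrite subrr mul0r subrr modc0.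
Qed.

Lemma holo_id A : holomorphic_on A (fun w => w).
Proof.
move=> z _; exists 1; apply/cderive_withinP => e e0; exists 1 => // w _ wz _.
by rewrite divff ?subr_eq0 // subrr modc0.
Qed.

Lemma holoD A f g : holomorphic_on A f -> holomorphic_on A g ->
  holomorphic_on A (fun w => f w + g w).
Proof.
move=> hf hg z Az; have [l hl] := hf z Az; have [m hm] := hg z Az.
exists (l + m); apply: cderive_within_eq (cvgD hl hm) _ => w _ wz.
rewrite -[LHS]/((f w - f z) / (w - z) + (g w - g z) / (w - z)).
by field.
Qed.

Lemma holoM A f g : holomorphic_on A f -> holomorphic_on A g ->
  holomorphic_on A (fun w => f w * g w).
Proof.
move=> hf hg z Az; have [l hl] := hf z Az; have [m hm] := hg z Az.
exists (l * g z + f z * m); have Hf := cderive_within_cvg hl.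
apply: cderive_within_eq (cvgD (cvgM hl (cvg_cst (g z))) (cvgM Hf hm)) _.
move=> w _ wz.
rewrite -[LHS]/((f w - f z) / (w - z) * g z + f w * ((g w - g z) / (w - z))).
by field.
Qed.

Lemma holoX A f n : holomorphic_on A f -> holomorphic_on A (fun w => f w ^+ n).
Proof.
move=> hf; elim: n => [|n IH].
  by apply: holo_ext (@holo_cst A 1) => w _; rewrite expr0.
by apply: holo_ext (holoM hf IH) => w _; rewrite exprS.
Qed.

Lemma holo_sum A (I : Type) (s : seq I) (F : I -> C -> C) :
  (forall i, holomorphic_on A (F i)) ->
  holomorphic_on A (fun w => \sum_(i <- s) F i w).
Proof.
move=> hF; elim: s => [|i s IH].
  by apply: holo_ext (@holo_cst A 0) => w _; rewrite big_nil.
by apply: holo_ext (holoD (hF i) IH) => w _; rewrite big_cons.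
Qed.

Lemma holo_prod A (I : Type) (s : seq I) (F : I -> C -> C) :
  (forall i, holomorphic_on A (F i)) ->
  holomorphic_on A (fun w => \prod_(i <- s) F i w).
Proof.
move=> hF; elim: s => [|i s IH].
  by apply: holo_ext (@holo_cst A 1) => w _; rewrite big_nil.
by apply: holo_ext (holoM (hF i) IH) => w _; rewrite big_cons.
Qed.

Lemma holoV A f : (forall w, A w -> f w != 0) -> holomorphic_on A f ->
  holomorphic_on A (fun w => (f w)^-1).
Proof.
move=> f0 hf z Az; have [l hl] := hf z Az.
have Hf := cderive_within_cvg hl; have fz := f0 _ Az.
exists (- (l * (f z)^-1 * (f z)^-1)).
apply: cderive_within_eq
  (cvgN (cvgM (cvgM hl (cvg_cst (f z)^-1)) (cvgV fz Hf))) _ => w Aw wz.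
rewrite -[LHS]/(- ((f w - f z) / (w - z) * (f z)^-1 * (f w)^-1)).
by field; rewrite wz fz f0.
Qed.

Lemma holo_affine A B f (a b : C) : a != 0 ->
  (forall w, B w -> A (a * w + b)) -> holomorphic_on A f ->
  holomorphic_on B (fun w => f (a * w + b)).
Proof.
move=> a0 BA hf z Bz; have [l /cderive_withinP hl] := hf _ (BA _ Bz).
exists (a * l); apply/cderive_withinP => e e0.
have ma0 : 0 < modc a by rewrite modc_gt0.
have [d d0 hd] := hl _ (divr_gt0 e0 ma0).
exists (d / modc a); first exact: divr_gt0.
move=> w Bw wz wd.
have E : a * w + b - (a * z + b) = a * (w - z) by ring.
have wz0 : w - z != 0 by rewrite subr_eq0.
have h1 : a * w + b != a * z + b by rewrite -subr_eq0 E mulf_neq0.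
have h2 : modc (a * w + b - (a * z + b)) < d.
  by rewrite E modcM mulrC -ltr_pdivlMr.
have := hd _ (BA _ Bw) h1 h2; rewrite E ltr_pdivlMr // -modcM => h.
apply: le_lt_trans h; rewrite le_eqVlt; apply/orP; left; apply/eqP; congr modc.
by field; rewrite wz0 a0.
Qed.

End Holomorphic.

(** * Trapezoid sums around squares *)

Section Contour.
Variable R : realType.
Local Notation C := (Cplx R).
Implicit Types (D : set C) (f g : C -> C) (p q a c z : C) (l : R).

(** The trapezoid sum of [g] from [p] to [q] with [2 ^ k] steps. Defined by
    halving, it makes every property below an induction on [k]. *)
Fixpoint trap g (k : nat) p q : C :=
  if k is k'.+1 then trap g k' p ((p + q) / 2) + trap g k' ((p + q) / 2) q
  else (g p + g q) / 2 * (q - p).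

(** A convexity condition just strong enough for the points of all the refined
    sums to stay in [D]. *)
Definition midclosed D := forall p q, D p -> D q -> D ((p + q) / 2).

Lemma modc2 : modc (2 : C) = 2.
Proof.
by rewrite modcE /rec /imc /= addr0 expr0n /= addr0 sqrtr_sqr ger0_norm.
Qed.

Lemma modc_half z : modc (z / 2) = modc z / 2.
Proof. by rewrite modcM modcV modc2. Qed.

Lemma imc_half z : imc (z / 2) = imc z / 2.
Proof.
have {2}-> : z = z / 2 + z / 2 by field.
by rewrite imcD; lra.
Qed.

Lemma rec_half z : rec (z / 2) = rec z / 2.
Proof.
have {2}-> : z = z / 2 + z / 2 by field.
by rewrite recD; lra.
Qed.

Lemma half_subl p q : (p + q) / 2 - p = (q - p) / 2.
Proof. by field. Qed.

Lemma half_subr p q : q - (p + q) / 2 = (q - p) / 2.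
Proof. by field. Qed.

Lemma trap_opp g k p q : trap g k q p = - trap g k p q.
Proof.
elim: k p q => [|k IH] p q /=; first by ring.
by rewrite [q + p]addrC [X in X + _ = _]IH [X in _ + X = _]IH; ring.
Qed.

Lemma trap_ext D f g k p q : midclosed D -> D p -> D q ->
  {in D, f =1 g} -> trap f k p q = trap g k p q.
Proof.
move=> mD Dp Dq fg; elim: k p q Dp Dq => [|k IH] p q Dp Dq /=.
  by rewrite !fg ?inE.
by have Dm := mD _ _ Dp Dq; rewrite !IH.
Qed.

Lemma trapB f g (b : C) k p q :
  trap (fun z => f z - b * g z) k p q = trap f k p q - b * trap g k p q.
Proof.
elim: k p q => [|k IH] p q /=; first by field.
by rewrite !IH; ring.
Qed.

Lemma trap_linear (b d : C) k p q :
  trap (fun z => b + d * z) k p q = b * (q - p) + d * (q ^+ 2 - p ^+ 2) / 2.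
Proof.
elim: k p q => [|k IH] p q /=; first by field.
by rewrite !IH; field.
Qed.

Lemma trap_le D g k p q (B : R) : midclosed D -> D p -> D q ->
  (forall z, D z -> modc (g z) <= B) -> modc (trap g k p q) <= B * modc (q - p).
Proof.
move=> mD Dp Dq gB; elim: k p q Dp Dq => [|k IH] p q Dp Dq /=.
  rewrite modcM ler_wpM2r ?modc_ge0 // modc_half.
  have := modcD (g p) (g q); have := gB _ Dp; have := gB _ Dq; lra.
have Dm := mD _ _ Dp Dq.
have h1 := IH _ _ Dp Dm; have h2 := IH _ _ Dm Dq.
rewrite half_subl modc_half in h1; rewrite half_subr modc_half in h2.
by apply: le_trans (modcD _ _) _; apply: le_trans (lerD h1 h2) _; lra.
Qed.

Lemma imc_trap_ge D g k p q (b : R) : midclosed D -> D p -> D q ->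
  (forall z, D z -> b <= imc (g z * (q - p))) -> b <= imc (trap g k p q).
Proof.
move=> mD; elim: k p q b => [|k IH] p q b Dp Dq gb /=.
  have -> : (g p + g q) / 2 * (q - p) = (g p * (q - p)) / 2 + (g q * (q - p)) / 2.
    by field.
  rewrite imcD !imc_half; have := gb _ Dp; have := gb _ Dq; lra.
have Dm := mD _ _ Dp Dq; rewrite imcD.
have -> : b = b / 2 + b / 2 by field.
apply: lerD; apply: IH => // z /gb; rewrite ?half_subl ?half_subr mulrA imc_half; lra.
Qed.

Definition square a l : set C :=
  [set z | rec a <= rec z <= rec a + l /\ imc a <= imc z <= imc a + l].

(** The trapezoid sum along the perimeter of the square with lower left corner
    [a] and side [l], run counterclockwise. *)
Definition contour g k a l : C :=
  trap g k a (a + cmk l 0) + trap g k (a + cmk l 0) (a + cmk l l) +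
  trap g k (a + cmk l l) (a + cmk 0 l) + trap g k (a + cmk 0 l) a.

(** The four inner edges are run twice, in opposite directions; the outer ones
    add up because refining by one step is the same as halving each edge. *)
Lemma contour_bisect g k a l (h := l / 2) :
  contour g k.+1 a l = contour g k a h + contour g k (a + cmk h 0) h +
    contour g k (a + cmk 0 h) h + contour g k (a + cmk h h) h.
Proof.
have lh : l = h + h by rewrite /h; field.
set e := cmk h 0; set v := cmk 0 h.
have -> : cmk h h = e + v.
  by apply: cplx_ext; rewrite ?recD ?imcD /= /cmk /= ?addr0 ?add0r.
rewrite /contour.
have -> : cmk l 0 = e + e.
  by apply: cplx_ext; rewrite ?recD ?imcD /= ?addr0 // lh.
have -> : cmk 0 l = v + v.
  by apply: cplx_ext; rewrite ?recD ?imcD /= ?addr0 // lh.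
have -> : cmk l l = e + e + (v + v).
  by apply: cplx_ext; rewrite ?recD ?imcD /= ?addr0 ?add0r // lh.
have -> : cmk h h = e + v.
  by apply: cplx_ext; rewrite ?recD ?imcD /= ?addr0 ?add0r.
rewrite -/e -/v /=.
have M1 : (a + (a + (e + e))) / 2 = a + e by field.
have M2 : (a + (e + e) + (a + (e + e + (v + v)))) / 2 = a + e + (e + v) by field.
have M3 : (a + (e + e + (v + v)) + (a + (v + v))) / 2 = a + v + (e + v) by field.
have M4 : (a + (v + v) + a) / 2 = a + v by field.
rewrite M1 M2 M3 M4.
have E1 : a + e + e = a + (e + e) by ring.
have E2 : a + v + v = a + (v + v) by ring.
have E3 : a + (e + v) + e = a + e + (e + v) by ring.
have E4 : a + (e + v) + (e + v) = a + (e + e + (v + v)) by ring.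
have E5 : a + (e + v) + v = a + v + (e + v) by ring.
have E6 : a + e + v = a + (e + v) by ring.
have E7 : a + v + e = a + (e + v) by ring.
rewrite E1 E2 E3 E4 E5 E6 E7.
rewrite (trap_opp g k (a + e) (a + (e + v))) (trap_opp g k (a + v) (a + (e + v))).
rewrite (trap_opp g k (a + (e + v)) (a + e + (e + v))).
rewrite (trap_opp g k (a + (e + v)) (a + v + (e + v))).
by ring.
Qed.

Lemma contour_affine (b d : C) k a l : contour (fun z => b + d * z) k a l = 0.
Proof. by rewrite /contour !trap_linear; field. Qed.

Lemma contourB f g (b : C) k a l :
  contour (fun z => f z - b * g z) k a l = contour f k a l - b * contour g k a l.
Proof. by rewrite /contour !trapB; ring. Qed.

Definition bottom_side a l : set C :=
  [set z | imc z = imc a /\ rec a <= rec z <= rec a + l].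
Definition top_side a l : set C :=
  [set z | imc z = imc a + l /\ rec a <= rec z <= rec a + l].
Definition left_side a l : set C :=
  [set z | rec z = rec a /\ imc a <= imc z <= imc a + l].
Definition right_side a l : set C :=
  [set z | rec z = rec a + l /\ imc a <= imc z <= imc a + l].

Definition perimeter a l : set C :=
  bottom_side a l `|` right_side a l `|` top_side a l `|` left_side a l.

Lemma perimeter_sub a l : 0 <= l -> perimeter a l `<=` square a l.
Proof.
move=> l0 z [[[]|]|] [E /andP[h1 h2]]; split; rewrite ?E; apply/andP; split; lra.
Qed.

Lemma side_midclosed a l :
  [/\ midclosed (bottom_side a l), midclosed (right_side a l),
      midclosed (top_side a l) & midclosed (left_side a l)].
Proof.
split=> p q [p1 /andP[p2 p3]] [q1 /andP[q2 q3]];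
  (split; rewrite ?rec_half ?imc_half ?recD ?imcD ?p1 ?q1; last apply/andP; last split);
  lra.
Qed.

Lemma side_ends a l : 0 <= l ->
  [/\ bottom_side a l a /\ bottom_side a l (a + cmk l 0),
      right_side a l (a + cmk l 0) /\ right_side a l (a + cmk l l),
      top_side a l (a + cmk l l) /\ top_side a l (a + cmk 0 l) &
      left_side a l (a + cmk 0 l) /\ left_side a l a].
Proof.
move=> l0; split; split; split; rewrite ?recD ?imcD ?rec_cmk ?imc_cmk;
  rewrite ?addr0 //; apply/andP; split; lra.
Qed.

Lemma contour_ext f g k a l : 0 <= l -> {in perimeter a l, f =1 g} ->
  contour f k a l = contour g k a l.
Proof.
move=> l0 fg; have [m1 m2 m3 m4] := side_midclosed a l.
have [[a1 b1] [a2 b2] [a3 b3] [a4 b4]] := side_ends a l0.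
rewrite /contour; do 3?[congr (_ + _)].
- apply: trap_ext m1 a1 b1 _ => z /set_mem h; apply: fg.
  by rewrite inE; left; left; left.
- apply: trap_ext m2 a2 b2 _ => z /set_mem h; apply: fg.
  by rewrite inE; left; left; right.
- by apply: trap_ext m3 a3 b3 _ => z /set_mem h; apply: fg; rewrite inE; left; right.
- by apply: trap_ext m4 a4 b4 _ => z /set_mem h; apply: fg; rewrite inE; right.
Qed.

Lemma modc_cmk_x l : 0 <= l -> modc (cmk l 0) = l.
Proof. by move=> l0; rewrite modcE /= expr0n /= addr0 sqrtr_sqr ger0_norm. Qed.

Lemma modc_cmk_y l : 0 <= l -> modc (cmk 0 l) = l.
Proof. by move=> l0; rewrite modcE /= expr0n /= add0r sqrtr_sqr ger0_norm. Qed.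

Lemma square_sides a l : 0 <= l ->
  [/\ modc (a + cmk l 0 - a) = l, modc (a + cmk l l - (a + cmk l 0)) = l,
      modc (a + cmk 0 l - (a + cmk l l)) = l & modc (a - (a + cmk 0 l)) = l].
Proof.
move=> l0; split.
- by rewrite [a + _]addrC addrK modc_cmk_x.
- rewrite -[RHS](modc_cmk_y l0); congr modc.
  by apply: cplx_ext; rewrite !(recD, imcD, recN, imcN) /=; ring.
- rewrite -[RHS](modc_cmk_x l0) -modcN; congr modc.
  by apply: cplx_ext; rewrite !(recD, imcD, recN, imcN) /=; ring.
- by rewrite -modcN opprB [a + _]addrC addrK modc_cmk_y.
Qed.

Lemma contour_le g k a l (B : R) : 0 <= l ->
  (forall z, perimeter a l z -> modc (g z) <= B) ->
  modc (contour g k a l) <= 4 * B * l.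
Proof.
move=> l0 gB; have [m1 m2 m3 m4] := side_midclosed a l.
have [[a1 b1] [a2 b2] [a3 b3] [a4 b4]] := side_ends a l0.
have [d1 d2 d3 d4] := square_sides a l0.
have h1 := trap_le k m1 a1 b1 (fun z h => gB z (or_introl (or_introl (or_introl h)))).
have h2 := trap_le k m2 a2 b2 (fun z h => gB z (or_introl (or_introl (or_intror h)))).
have h3 := trap_le k m3 a3 b3 (fun z h => gB z (or_introl (or_intror h))).
have h4 := trap_le k m4 a4 b4 (fun z h => gB z (or_intror h)).
rewrite d1 in h1; rewrite d2 in h2; rewrite d3 in h3; rewrite d4 in h4.
apply: le_trans (modcD _ _) _.
apply: le_trans (lerD (le_trans (modcD _ _) (lerD (modcD _ _) (lexx _))) (lexx _)) _.
by apply: le_trans (lerD (lerD (lerD h1 h2) h3) h4) _; lra.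
Qed.

Definition corner a l (b : bool * bool) : C :=
  a + cmk (b.1%:R * l) (b.2%:R * l).

Lemma exists_pow2_gt (x y : R) : 0 < y -> exists j, x / 2 ^+ j < y.
Proof.
move=> y0; exists (Num.truncn (x / y)).+1.
rewrite ltr_pdivrMr ?exprn_gt0 // mulrC -ltr_pdivrMr //.
apply: lt_le_trans (truncnS_gt _) _.
by rewrite -natrX ler_nat ltnW // ltn_expl.
Qed.

(** If [P] failed on the whole square, it would fail on nested squares with
    sides tending to 0, against the local hypothesis at their common point. Both
    Goursat's theorem and the compactness of bounded closed sets come from
    this. *)
Lemma square_bisection (P : C -> R -> Prop) a0 l0 : 0 < l0 ->
  (forall a l, 0 < l -> (forall b, P (corner a (l / 2) b) (l / 2)) -> P a l) ->
  (forall z, square a0 l0 z -> exists2 d : R, 0 < d & forall a l, 0 < l < d ->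
     square a l `<=` square a0 l0 -> square a l z -> P a l) ->
  P a0 l0.
Proof.
move=> l00 H1 H2; apply: contrapT => nP.
have /choice[nxt hnxt] : forall s : C * R, exists b, 0 < s.2 ->
    ~ P s.1 s.2 -> ~ P (corner s.1 (s.2 / 2) b) (s.2 / 2).
  case=> a l /=; apply: contrapT => /forallNP h.
  apply: (h (true, true)) => l1 nPl; case: nPl.
  apply: H1 => // b; apply: contrapT => nb; apply: (h b) => _ _; exact: nb.
pose step s : C * R := (corner s.1 (s.2 / 2) (nxt s), s.2 / 2).
pose s j := iter j step (a0, l0).
have sl j : (s j).2 = l0 / 2 ^+ j.
  elim: j => [|j /= ->]; first by rewrite expr0 divr1.
  by rewrite exprSr invfM mulrA.
have sl0 j : 0 < (s j).2 by rewrite sl divr_gt0 // exprn_gt0.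
have nPs j : ~ P (s j).1 (s j).2 by elim: j => [//|j IH]; exact: hnxt.
have sqS j : [/\ rec (s j).1 <= rec (s j.+1).1,
    rec (s j.+1).1 + (s j.+1).2 <= rec (s j).1 + (s j).2,
    imc (s j).1 <= imc (s j.+1).1 &
    imc (s j.+1).1 + (s j.+1).2 <= imc (s j).1 + (s j).2].
  have := sl0 j; rewrite /= /corner recD imcD rec_cmk imc_cmk.
  by case: (nxt _) => -[] [] /= ?; split; lra.
have sqD j i : [/\ rec (s j).1 <= rec (s (i + j)%N).1,
    rec (s (i + j)%N).1 + (s (i + j)%N).2 <= rec (s j).1 + (s j).2,
    imc (s j).1 <= imc (s (i + j)%N).1 &
    imc (s (i + j)%N).1 + (s (i + j)%N).2 <= imc (s j).1 + (s j).2].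
  elim: i => [|i [i1 i2 i3 i4]]; first by split.
  rewrite addSn; have [j1 j2 j3 j4] := sqS (i + j)%N.
  by split; [apply: le_trans j1|apply: le_trans i2|apply: le_trans j3|
             apply: le_trans i4].
have sqle i j : rec (s i).1 <= rec (s j).1 + (s j).2 /\
                imc (s i).1 <= imc (s j).1 + (s j).2.
  have := sl0 i; have := sl0 j; have [/subnK <-|/ltnW/subnK <-] := leqP i j.
    by have [] := sqD i (j - i)%N; lra.
  by have [] := sqD j (i - j)%N; lra.
(* The lower left corners increase, and their supremum is in all squares. *)
pose x := sup (range (fun j => rec (s j).1)).
pose y := sup (range (fun j => imc (s j).1)).
have inx j : rec (s j).1 <= x <= rec (s j).1 + (s j).2.
  apply/andP; split.
    apply: ub_le_sup; last by exists j.
    by exists (rec (s j).1 + (s j).2) => _ [i _ <-]; case: (sqle i j).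
  apply: ge_sup; first by exists (rec (s j).1); exists j.
  by move=> _ [i _ <-]; case: (sqle i j).
have iny j : imc (s j).1 <= y <= imc (s j).1 + (s j).2.
  apply/andP; split.
    apply: ub_le_sup; last by exists j.
    by exists (imc (s j).1 + (s j).2) => _ [i _ <-]; case: (sqle i j).
  apply: ge_sup; first by exists (imc (s j).1); exists j.
  by move=> _ [i _ <-]; case: (sqle i j).
have [d d0 hd] := H2 (cmk x y) (conj (inx 0) (iny 0)).
have [j hj] := exists_pow2_gt l0 d0.
apply: (nPs j); apply: hd.
- by rewrite sl0 sl.
- have := sqD 0 j; rewrite addn0 => -[j1 j2 j3 j4].
  move=> z [/andP[z1 z2] /andP[z3 z4]]; move: j1 j2 j3 j4.
  by move=> /= *; split; apply/andP; split; lra.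
- exact: conj (inx j) (iny j).
Qed.

End Contour.

(** * Goursat's theorem with an exceptional point *)

Section Goursat.
Variable R : realType.
Local Notation C := (Cplx R).
Implicit Types (D : set C) (f g h : C -> C) (p q a c z : C) (l : R).

(** This is 1 for [x] inside the interval from [t] to [t + l], 1/2 at its ends
    and 0 outside. As a difference of two signs it is additive when the interval
    is cut, and so is the product [angle_wt] when a square is cut into four. *)
Definition edge_wt (x t l : R) : R := (Num.sg (x - t) - Num.sg (x - (t + l))) / 2.

Lemma edge_wt_ge0 x t l : 0 < l -> 0 <= edge_wt x t l.
Proof.
move=> l0; rewrite /edge_wt.
by case: (sgrP (x - t)); case: (sgrP (x - (t + l))); lra.
Qed.

Lemma edge_wt_ge_half x t l : 0 < l -> t <= x <= t + l -> 1 / 2 <= edge_wt x t l.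
Proof.
move=> l0 /andP[h1 h2]; rewrite /edge_wt.
by case: (sgrP (x - t)); case: (sgrP (x - (t + l))); lra.
Qed.

(** The fraction of a small disc around [c] that lies in the square. *)
Definition angle_wt c a l : R := edge_wt (rec c) (rec a) l * edge_wt (imc c) (imc a) l.

Lemma angle_wt_ge0 c a l : 0 < l -> 0 <= angle_wt c a l.
Proof. by move=> l0; rewrite mulr_ge0 ?edge_wt_ge0. Qed.

Lemma angle_wt_in c a l : 0 < l -> square a l c -> 1 / 4 <= angle_wt c a l.
Proof.
move=> l0 [/(edge_wt_ge_half l0) h1 /(edge_wt_ge_half l0) h2].
apply: le_trans (ler_pM _ _ h1 h2) => //; lra.
Qed.

Lemma angle_wt_bisect c a l (h := l / 2) :
  angle_wt c a l = angle_wt c a h + angle_wt c (a + cmk h 0) h +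
    angle_wt c (a + cmk 0 h) h + angle_wt c (a + cmk h h) h.
Proof.
have lh : l = h + h by rewrite /h; field.
rewrite /angle_wt /edge_wt !recD !imcD !rec_cmk !imc_cmk !addr0 lh !addrA.
by field.
Qed.

Lemma corner00 a l : corner a l (false, false) = a.
Proof. by rewrite /corner !mul0r; apply: cplx_ext; rewrite ?recD ?imcD addr0. Qed.
Lemma corner10 a l : corner a l (true, false) = a + cmk l 0.
Proof. by rewrite /corner mul0r mul1r. Qed.
Lemma corner01 a l : corner a l (false, true) = a + cmk 0 l.
Proof. by rewrite /corner mul0r mul1r. Qed.
Lemma corner11 a l : corner a l (true, true) = a + cmk l l.
Proof. by rewrite /corner mul1r. Qed.

Lemma square_diam a l z w : 0 <= l -> square a l z -> square a l w ->
  modc (w - z) <= 2 * l.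
Proof.
move=> l0 [/andP[z1 z2] /andP[z3 z4]] [/andP[w1 w2] /andP[w3 w4]].
apply: le_trans (modc_le_recim _) _; rewrite recD imcD recN imcN.
have : `|rec w - rec z| <= l by rewrite ler_norml; apply/andP; split; lra.
have : `|imc w - imc z| <= l by rewrite ler_norml; apply/andP; split; lra.
lra.
Qed.

(** Subtracting the affine approximation at [z] does not change the sum around
    the square, and leaves a function of size [2 * e * l] on an edge of length
    [l]. *)
Lemma contour_le_deriv h a l z (d : C) (e : R) : 0 < l -> 0 <= e ->
  square a l z ->
  (forall w, square a l w -> w != z ->
     modc ((h w - h z) / (w - z) - d) <= e) ->
  forall k, modc (contour h k a l) <= 8 * e * l ^+ 2.
Proof.
move=> l0 e0 sz H k; have l0' := ltW l0.
(* The coefficient 1 gives [r] the shape that [contourB] expects. *)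
pose r w := h w - 1 * ((h z - d * z) + d * w).
have -> : contour h k a l = contour r k a l.
  by rewrite contourB contour_affine mulr0 subr0.
have hr w : square a l w -> modc (r w) <= e * (2 * l).
  move=> sw; have [->|wz] := eqVneq w z.
    have -> : r z = 0 by rewrite /r; ring.
    by rewrite modc0 !mulr_ge0.
  have wz0 : w - z != 0 by rewrite subr_eq0.
  have -> : r w = ((h w - h z) / (w - z) - d) * (w - z) by rewrite /r; field.
  rewrite modcM; apply: ler_pM; rewrite ?modc_ge0 //; first exact: H.
  exact: square_diam sz sw.
apply: le_trans (contour_le _ l0' (fun w pw => hr w (perimeter_sub l0' pw))) _.
lra.
Qed.

(** At the exceptional point [c] only boundedness is available, which makes the
    sum around a small square small, but not small compared with its area. An
    error term that is a multiple of [angle_wt] absorbs this: it is additive, so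
    that it survives the bisection, and at least 1/4 on squares containing
    [c]. *)
Theorem goursat h c (B : R) a0 l0 : 0 < l0 ->
  (forall z, square a0 l0 z -> modc (h z) <= B) ->
  holomorphic_on (square a0 l0 `\` [set c]) h ->
  forall e, 0 < e -> exists K, forall k, (K <= k)%N ->
    modc (contour h k a0 l0) <= e * (l0 ^+ 2 + angle_wt c a0 l0).
Proof.
move=> l00 hB hol e e0.
apply: (square_bisection (P := fun a l => exists K, forall k, (K <= k)%N ->
    modc (contour h k a l) <= e * (l ^+ 2 + angle_wt c a l))) => //.
  move=> a l l1 Pb.
  have [K1 h1] := Pb (false, false); have [K2 h2] := Pb (true, false).
  have [K3 h3] := Pb (false, true); have [K4 h4] := Pb (true, true).
  rewrite corner00 in h1; rewrite corner10 in h2.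
  rewrite corner01 in h3; rewrite corner11 in h4.
  exists (maxn (maxn K1 K2) (maxn K3 K4)).+1 => -[//|k].
  rewrite ltnS !geq_max => /andP[/andP[k1 k2] /andP[k3 k4]].
  rewrite contour_bisect angle_wt_bisect.
  have := h1 _ k1; have := h2 _ k2; have := h3 _ k3; have := h4 _ k4.
  set c1 := contour _ _ _ _; set c2 := contour _ _ _ _.
  set c3 := contour _ _ _ _; set c4 := contour _ _ _ _ => b4 b3 b2 b1.
  apply: le_trans (modcD _ _) _.
  apply: le_trans (lerD (le_trans (modcD _ _) (lerD (modcD _ _) (lexx _))) (lexx _)) _.
  by lra.
move=> z sz; have [zc|zc] := eqVneq z c.
  have B0 : 0 <= B by apply: le_trans (hB _ sz); exact: modc_ge0.
  exists (e / (16 * (B + 1))); first by rewrite divr_gt0 // mulr_gt0 //; lra.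
  move=> a l /andP[l1 l2] sub szl; exists 0 => k _.
  have := contour_le k (ltW l1) 
    (fun w pw => hB _ (sub _ (perimeter_sub (ltW l1) pw))).
  move/le_trans; apply.
  have := angle_wt_in l1 szl; rewrite zc => w4.
  rewrite ltr_pdivlMr in l2; last by rewrite mulr_gt0 //; lra.
  have : e * (1/4) <= e * angle_wt c a l by rewrite ler_pM2l.
  have : 0 <= e * l ^+ 2 by rewrite mulr_ge0 ?sqr_ge0 // ltW.
  nra.
have [d /cderive_withinP hd] := hol z (conj sz (fun E => elimN eqP zc E)).
have e8 : 0 < e / 8 by lra.
have [d1 d10 hd1] := hd _ e8.
have zc0 : 0 < modc (z - c) by rewrite modc_gt0 subr_eq0.
exists (Num.min (d1 / 2) (modc (z - c) / 2)).
  by rewrite lt_min !divr_gt0.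
move=> a l /andP[l1]; rewrite lt_min => /andP[l2 l3] sub szl; exists 0 => k _.
apply: le_trans (contour_le_deriv (e := e / 8) l1 (ltW e8) szl _ k) _.
  move=> w sw wz; have := square_diam (ltW l1) szl sw => dw.
  apply/ltW/hd1 => //; last by lra.
  split; first exact: sub.
  move=> wc; rewrite /= in wc; rewrite wc modcB in dw; lra.
have := angle_wt_ge0 c a l1 => w0.
have : 0 <= e * angle_wt c a l by rewrite mulr_ge0 // ltW.
lra.
Qed.

End Goursat.

(** * The value at the centre of a square *)

Section Maximum.
Variable R : realType.
Local Notation C := (Cplx R).
Implicit Types (D : set C) (f g h : C -> C) (p q a c z : C) (s : R).

Definition csquare c s : set C := square (c - cmk s s) (2 * s).

Lemma rec_csq c s : rec (c - cmk s s) = rec c - s.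
Proof. by rewrite recD recN. Qed.
Lemma imc_csq c s : imc (c - cmk s s) = imc c - s.
Proof. by rewrite imcD imcN. Qed.

Lemma cmkV (x y : R) :
  (cmk x y)^-1 = cmk (x / (x ^+ 2 + y ^+ 2)) (- (y / (x ^+ 2 + y ^+ 2))).
Proof. by []. Qed.

Lemma cmkE z : z = cmk (rec z) (imc z).
Proof. by case: z. Qed.

(** For [z - c = s + i * x] and an edge vector [2 * s * i], the right-hand side
    is the imaginary part of the edge vector divided by [z - c]. *)
Lemma kernel_side_ge (x s : R) : 0 < s -> - s <= x <= s ->
  1 <= s / (s ^+ 2 + x ^+ 2) * (2 * s).
Proof.
move=> s0 /andP[x1 x2]; have s2 : 0 < s ^+ 2 by rewrite exprn_gt0.
have N0 : 0 < s ^+ 2 + x ^+ 2 by rewrite ltr_wpDr ?sqr_ge0.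
rewrite mulrAC ler_pdivlMr // mul1r; nra.
Qed.

(** The counterpart of the winding number: each side contributes at least 1 to
    the imaginary part. The exact value is 2 pi, but a positive lower bound is
    all that is used. *)
Lemma contour_kernel_ge c s k : 0 < s ->
  4 <= imc (contour (fun z => (z - c)^-1) k (c - cmk s s) (2 * s)).
Proof.
move=> s0; have l0 : 0 <= 2 * s by lra.
have [m1 m2 m3 m4] := side_midclosed (c - cmk s s) (2 * s).
have [[a1 b1] [a2 b2] [a3 b3] [a4 b4]] := side_ends (c - cmk s s) l0.
have -> : 4 = 1 + 1 + 1 + 1 :> R by ring.
rewrite !imcD; apply: lerD; first apply: lerD; first apply: lerD.
- apply: imc_trap_ge m1 a1 b1 _ => z; rewrite /bottom_side /= rec_csq imc_csq => -[hi hr].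
  rewrite [z - c]cmkE cmkV imcM !(recD, imcD, recN, imcN, rec_cmk, imc_cmk) hi.
  set x := rec z - rec c.
  have := @kernel_side_ge x s s0.
  have -> : imc c - s - imc c = - s by ring.
  rewrite sqrrN [x ^+ 2 + _]addrC => H; apply: le_trans (H _) _.
    by rewrite /x; case/andP: hr => *; apply/andP; split; lra.
  lra.
- apply: imc_trap_ge m2 a2 b2 _ => z; rewrite /right_side /= rec_csq imc_csq => -[hi hr].
  rewrite [z - c]cmkE cmkV imcM !(recD, imcD, recN, imcN, rec_cmk, imc_cmk) hi.
  set x := imc z - imc c.
  have := @kernel_side_ge x s s0.
  have -> : rec c - s + 2 * s - rec c = s by ring.
  move=> H; apply: le_trans (H _) _.
    by rewrite /x; case/andP: hr => *; apply/andP; split; lra.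
  lra.
- apply: imc_trap_ge m3 a3 b3 _ => z; rewrite /top_side /= rec_csq imc_csq => -[hi hr].
  rewrite [z - c]cmkE cmkV imcM !(recD, imcD, recN, imcN, rec_cmk, imc_cmk) hi.
  set x := rec z - rec c.
  have := @kernel_side_ge x s s0.
  have -> : imc c - s + 2 * s - imc c = s by ring.
  rewrite [x ^+ 2 + _]addrC => H; apply: le_trans (H _) _.
    by rewrite /x; case/andP: hr => *; apply/andP; split; lra.
  lra.
- apply: imc_trap_ge m4 a4 b4 _ => z; rewrite /left_side /= rec_csq imc_csq => -[hi hr].
  rewrite [z - c]cmkE cmkV imcM !(recD, imcD, recN, imcN, rec_cmk, imc_cmk) hi.
  set x := imc z - imc c.
  have := @kernel_side_ge x s s0.
  have -> : rec c - s - rec c = - s by ring.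
  rewrite sqrrN => H; apply: le_trans (H _) _.
    by rewrite /x; case/andP: hr => *; apply/andP; split; lra.
  lra.
Qed.

Lemma perimeter_dist c s z : 0 < s -> perimeter (c - cmk s s) (2 * s) z ->
  s <= modc (z - c).
Proof.
move=> s0; have hr := rec_le_modc (z - c); have hi := imc_le_modc (z - c).
rewrite recD recN in hr; rewrite imcD imcN in hi.
move: hr hi; rewrite !ler_norml => /andP[hr1 hr2] /andP[hi1 hi2].
by move=> [[[]|]|] [] /=; rewrite ?rec_csq ?imc_csq => E _; lra.
Qed.

Lemma csquare_center c s : 0 < s -> csquare c s c.
Proof.
by move=> s0; split; rewrite ?rec_csq ?imc_csq; apply/andP; split; lra.
Qed.

Lemma difference_quotient_bounded g c s (B : R) : 0 < s ->
  holomorphic_on (csquare c s) g ->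
  (forall z, csquare c s z -> modc (g z) <= B) ->
  exists B', forall z, csquare c s z -> modc ((g z - g c) / (z - c)) <= B'.
Proof.
move=> s0 hg gB; have sc := csquare_center c s0.
have [l /cderive_withinP/(_ _ ltr01)[d d0 hd]] := hg _ sc.
have B0 : 0 <= B by apply: le_trans (gB _ sc); exact: modc_ge0.
have K0 : 0 <= 2 * B / d by rewrite divr_ge0 ?mulr_ge0 // ltW.
exists (modc l + 1 + 2 * B / d) => z sz.
have L0 := modc_ge0 l.
have [->|zc] := eqVneq z c; first by rewrite subrr mul0r modc0; lra.
have [zd|dz] := ltP (modc (z - c)) d.
  have := hd z sz zc zd => h.
  have := modcD ((g z - g c) / (z - c) - l) l; rewrite subrK => h'; lra.
rewrite modcM modcV.
have h : modc (g z - g c) <= 2 * B.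
  have := modcD (g z) (- g c); rewrite modcN; have := gB _ sz; have := gB _ sc; lra.
have : modc (g z - g c) / modc (z - c) <= 2 * B / d.
  apply: ler_pM => //; rewrite ?modc_ge0 ?invr_ge0 ?modc_ge0 //.
  by rewrite lef_pV2 // posrE; lra.
lra.
Qed.

(** Cauchy's formula with constants. For [h z = (g z - g c) / (z - c)] the sums
    around the square tend to 0, so that [g c] times the sum of [1 / (z - c)],
    of modulus at least 4, is arbitrarily close to the sum of [g z / (z - c)],
    of modulus at most [8 * M]. *)
Lemma center_le_double g c s (B M : R) : 0 < s ->
  holomorphic_on (csquare c s) g ->
  (forall z, csquare c s z -> modc (g z) <= B) ->
  (forall z, perimeter (c - cmk s s) (2 * s) z -> modc (g z) <= M) ->
  modc (g c) <= 2 * M.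
Proof.
move=> s0 hg gB gM; have l0 : 0 < 2 * s by lra.
have [B' hB'] := difference_quotient_bounded s0 hg gB.
pose h z := (g z - g c) / (z - c).
have hol : holomorphic_on (csquare c s `\` [set c]) h.
  apply: holoM.
    apply: holoD; last exact: holo_cst.
    by apply: holo_sub hg => z [].
  apply: holoV; last by apply: holoD; [exact: holo_id|exact: holo_cst].
  by move=> w [_ /eqP wc]; rewrite subr_eq0.
apply/ler_addgt0Pr => e e0.
set W := (2 * s) ^+ 2 + angle_wt c (c - cmk s s) (2 * s).
have W0 : 0 < W.
  rewrite ltr_pwDl ?exprn_gt0 //; exact: angle_wt_ge0.
have [K hK] := goursat l0 hB' hol (divr_gt0 e0 W0).
have := hK _ (leqnn K); rewrite -/W divfK ?gt_eqF //.
have -> : contour h K (c - cmk s s) (2 * s) =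
    contour (fun z => g z / (z - c) - g c * (z - c)^-1) K (c - cmk s s) (2 * s).
  by apply: contour_ext; [lra|move=> z _; rewrite /h mulrBl].
rewrite contourB; set X := contour _ _ _ _; set Y := contour _ _ _ _ => hXY.
have hY : 4 <= modc Y.
  by apply: le_trans (imc_le_modc _); apply: le_trans (ler_norm _); exact: contour_kernel_ge.
have hX : modc X <= 4 * (M / s) * (2 * s).
  apply: contour_le; first by lra.
  move=> z pz; have hz := perimeter_dist s0 pz; rewrite modcM modcV.
  apply: ler_pM; rewrite ?modc_ge0 ?invr_ge0 ?modc_ge0 //; first exact: gM.
  by rewrite lef_pV2 // posrE; lra.
have E : 4 * (M / s) * (2 * s) = 8 * M by field; lra.
have := modcD X (- (X - g c * Y)); rewrite opprB addrC subrK modcM => h1.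
rewrite -[modc (_ - X)]modcN opprB in h1.
have h2 : modc (g c) * 4 <= modc (g c) * modc Y by rewrite ler_wpM2l ?modc_ge0.
lra.
Qed.

Lemma bernoulli_le (t : R) m : 1 <= t -> 1 + m%:R * (t - 1) <= t ^+ m.
Proof.
move=> t1; elim: m => [|m IH]; first by rewrite mul0r addr0 expr0.
rewrite exprS -natr1; have m0 : 0 <= m%:R :> R by [].
have : t * (1 + m%:R * (t - 1)) <= t * t ^+ m by rewrite ler_wpM2l //; lra.
have : 0 <= m%:R * (t - 1) ^+ 2 by rewrite mulr_ge0 ?sqr_ge0.
lra.
Qed.

Lemma le_of_expn_le (x y K : R) : 0 <= y ->
  (forall m, x ^+ m <= K * y ^+ m) -> x <= y.
Proof.
move=> y0 H; rewrite leNgt; apply/negP => yx.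
have [y1|y1] := eqVneq y 0.
  by have := H 1%N; rewrite y1 !expr1 mulr0; lra.
have yp : 0 < y by rewrite lt0r y1.
have t1 : 1 < x / y by rewrite ltr_pdivlMr // mul1r.
have K0 : 0 < x / y - 1 by lra.
have hm m : 1 + m%:R * (x / y - 1) <= K.
  apply: le_trans (bernoulli_le m (ltW t1)) _.
  by rewrite expr_div_n ler_pdivrMr // exprn_gt0.
have := hm (Num.truncn (K / (x / y - 1))).+1.
have := truncnS_gt (K / (x / y - 1)); rewrite ltr_pdivrMr //.
lra.
Qed.

(** Applying [center_le_double] to [g ^ m] gives [|g c|^m <= 2 * M^m] for every
    [m], and the constant 2 is lost in the limit. *)
Theorem center_le_perimeter g c s (B M : R) : 0 < s ->
  holomorphic_on (csquare c s) g ->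
  (forall z, csquare c s z -> modc (g z) <= B) ->
  (forall z, perimeter (c - cmk s s) (2 * s) z -> modc (g z) <= M) ->
  modc (g c) <= M.
Proof.
move=> s0 hg gB gM; have l0 : 0 <= 2 * s by lra.
have [[a1 _] _ _ _] := side_ends (c - cmk s s) l0.
have M0 : 0 <= M.
  by apply: le_trans (modc_ge0 _) (gM _ _); left; left; left; exact: a1.
apply: (@le_of_expn_le _ _ 2) => // m; rewrite -modcX.
apply: (@center_le_double (fun z => g z ^+ m) c s (B ^+ m)) => //.
- exact: holoX.
- by move=> z /gB h; rewrite modcX lerXn2r ?nnegrE ?modc_ge0 // (le_trans _ h) ?modc_ge0.
- by move=> z /gM h; rewrite modcX lerXn2r ?nnegrE ?modc_ge0.
Qed.

Lemma rotate_csquare c s (u : C) z : u \in [:: cmk 0 1; cmk (-1) 0; cmk 0 (-1)] ->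
  csquare c s z -> csquare c s (u * z + (c - u * c)).
Proof.
rewrite !inE /csquare /square /= rec_csq imc_csq => hu [/andP[h1 h2] /andP[h3 h4]].
case/or3P: hu => /eqP ->; rewrite !(recD, imcD, recN, imcN, recM, imcM) !rec_cmk !imc_cmk;
  by split; apply/andP; split; lra.
Qed.

(** The product of the four copies of [g] rotated about [c] by quarter turns
    takes the value [g c ^ 4] at [c]. At each point of the perimeter one of the
    four rotated points is on the bottom side. *)
Theorem center_le_bottom g c s (M S : R) : 0 < s ->
  holomorphic_on (csquare c s) g ->
  (forall z, csquare c s z -> modc (g z) <= M) ->
  (forall z, csquare c s z -> imc z = imc c - s -> modc (g z) <= S) ->
  modc (g c) ^+ 4 <= S * M ^+ 3.
Proof.
move=> s0 hg gM gS; have l0 : 0 <= 2 * s by lra.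
have sc := csquare_center c s0.
have M0 : 0 <= M by apply: le_trans (gM _ sc); exact: modc_ge0.
pose rot u z := u * z + (c - u * c).
pose u1 : C := cmk 0 1; pose u2 : C := cmk (-1) 0; pose u3 : C := cmk 0 (-1).
have r1 z : csquare c s z -> csquare c s (rot u1 z).
  by apply: rotate_csquare; rewrite !inE eqxx.
have r2 z : csquare c s z -> csquare c s (rot u2 z).
  by apply: rotate_csquare; rewrite !inE eqxx orbT.
have r3 z : csquare c s z -> csquare c s (rot u3 z).
  by apply: rotate_csquare; rewrite !inE eqxx !orbT.
pose G z := g z * g (rot u1 z) * (g (rot u2 z) * g (rot u3 z)).
have rc u : rot u c = c by rewrite /rot addrC subrK.
have -> : modc (g c) ^+ 4 = modc (G c) by rewrite /G !rc !modcM; ring.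
have u_neq0 (x y : R) : `|x| + `|y| != 0 -> cmk x y != 0.
  apply: contraNneq => /= E; have := congr1 (@rec R) E; have := congr1 (@imc R) E.
  by rewrite /= => -> ->; rewrite normr0 addr0.
have hG : holomorphic_on (csquare c s) G.
  apply: holoM; apply: holoM => //; apply: holo_affine hg => //;
    by apply: u_neq0; rewrite ?normr0 ?normrN ?normr1 ?addr0 ?add0r oner_neq0.
apply: (@center_le_perimeter G c s (M ^+ 4)) => //.
  move=> z sz; rewrite /G !modcM.
  have -> : M ^+ 4 = M * M * (M * M) by ring.
  by rewrite !ler_pM ?mulr_ge0 ?modc_ge0 ?gM //; auto.
move=> z pz; have sz : csquare c s z := perimeter_sub l0 pz.
have -> : S * M ^+ 3 = S * M * (M * M) by ring.
have R1 := gM _ (r1 _ sz); have R2 := gM _ (r2 _ sz); have R3 := gM _ (r3 _ sz).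
have R0 := gM _ sz.
have S1 := gS _ (r1 _ sz); have S2 := gS _ (r2 _ sz); have S3 := gS _ (r3 _ sz).
have S0 := gS _ sz.
rewrite !(recD, imcD, recN, imcN, recM, imcM) !rec_cmk !imc_cmk in S1.
rewrite !(recD, imcD, recN, imcN, recM, imcM) !rec_cmk !imc_cmk in S2.
rewrite !(recD, imcD, recN, imcN, recM, imcM) !rec_cmk !imc_cmk in S3.
rewrite /G !modcM.
move: pz => [[[]|]|] [] /=; rewrite ?rec_csq ?imc_csq => E _.
- by rewrite !ler_pM ?mulr_ge0 ?modc_ge0 // S0.
- rewrite [X in _ <= X](_ : _ = M * M * (M * S)); last by ring.
  by rewrite !ler_pM ?mulr_ge0 ?modc_ge0 // S3 //; lra.
- rewrite [X in _ <= X](_ : _ = M * M * (S * M)); last by ring.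
  by rewrite !ler_pM ?mulr_ge0 ?modc_ge0 // S2 //; lra.
- rewrite [X in _ <= X](_ : _ = M * S * (M * M)); last by ring.
  by rewrite !ler_pM ?mulr_ge0 ?modc_ge0 // S1 //; lra.
Qed.

End Maximum.

(** * The maximum principle and the three circles theorem *)

Section Compactness.
Variable R : realType.
Local Notation C := (Cplx R).
Implicit Types (K : set C) (g h : C -> C) (a c z u : C) (l s r rho : R).

(** Closedness is put in the form that directly extends a covering of [K] to a
    covering of a square. *)
Definition closed_bounded K : Prop :=
  (forall z, ~ K z -> \forall w \near z, ~ K w) /\
  exists a, exists2 l, 0 < l & K `<=` square a l.

(** Heine-Borel, by bisection of a square containing [K]. *)
Lemma closed_bounded_near_covering K : closed_bounded K ->
  near_covering_within K.
Proof.
move=> [Kc [a0 [l0 l00 Ka]]] I F P FF cov.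
suff : (fun a l => \near F, square a l `&` K `<=` P F) a0 l0.
  by apply: filterS => i Pi z Kz; apply: Pi; split => //; exact: Ka.
apply: (square_bisection (P := fun a l => \near F, square a l `&` K `<=` P F)) => //.
  move=> a l l1 Pb.
  have P4 := Pb (false, false); have P3 := Pb (true, false).
  have P2 := Pb (false, true); have P1 := Pb (true, true); move: P4 P3 P2 P1.
  rewrite corner00 corner10 corner01 corner11 => F4 F3 F2 F1; near=> i.
  have P4 : square a (l / 2) `&` K `<=` P i by near: i.
  have P3 : square (a + cmk (l / 2) 0) (l / 2) `&` K `<=` P i by near: i.
  have P2 : square (a + cmk 0 (l / 2)) (l / 2) `&` K `<=` P i by near: i.
  have P1 : square (a + cmk (l / 2) (l / 2)) (l / 2) `&` K `<=` P i by near: i.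
  move=> z [[/andP[z1 z2] /andP[z3 z4]] Kz].
  have [zl|zr] := leP (rec z) (rec a + l / 2);
    have [zb|zt] := leP (imc z) (imc a + l / 2).
  - by apply: P4; do !split => //; apply/andP; split; lra.
  - by apply: P2; do !split => //; rewrite ?recD ?imcD ?rec_cmk ?imc_cmk; apply/andP; split; lra.
  - by apply: P3; do !split => //; rewrite ?recD ?imcD ?rec_cmk ?imc_cmk; apply/andP; split; lra.
  - by apply: P1; do !split => //; rewrite ?recD ?imcD ?rec_cmk ?imc_cmk; apply/andP; split; lra.
move=> z sz.
have : \forall x' \near z & i \near F, K x' -> P i x'.
  have [/cov//|/Kc nK] := pselect (K z).
  by exists ([set w | ~ K w], setT); [split => //; exact: filterT|move=> [x i] [/= nKx _ /nKx]].
move=> [[A B] [/= /nbhs_modcP[d d0 hd] FB] hAB].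
exists (d / 2); first by rewrite divr_gt0.
move=> b l /andP[l1 l2] _ szb; apply: filterS FB => i Bi w [sw Kw].
apply: (hAB (w, i)) => //; split => //=; apply: hd.
have := square_diam (ltW l1) szb sw; lra.
Unshelve. all: by end_near. Qed.

(** If the supremum of [phi] is not attained, then [phi] is bounded away from it
    near each point of [K], hence on [K] by compactness. *)
Lemma extreme_value K (phi : C -> R) : closed_bounded K -> K !=set0 ->
  (forall z e, K z -> 0 < e -> \forall w \near z, K w -> phi w < phi z + e) ->
  exists2 z, K z & forall w, K w -> phi w <= phi z.
Proof.
move=> cK [z0 Kz0] usc; have cov := closed_bounded_near_covering cK.
have [B hB] : exists B, forall z, K z -> phi z <= B.
  have [|B [_ hB]] := @cov R (pinfty_nbhs R) (fun B z => phi z <= B) _.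
    move=> z Kz; exists ([set w | K w -> phi w < phi z + 1], [set B | phi z + 1 < B]).
      split; first exact: usc.
      by exists (phi z + 1); split; rewrite ?num_real.
    by move=> [w B] [/= hw hB] /hw; lra.
  by exists (B + 1) => z Kz; apply: (hB (B + 1)) => //; lra.
pose M := sup (phi @` K).
have hM z : K z -> phi z <= M.
  by move=> Kz; apply: ub_le_sup; [exists B => _ [w Kw <-]; exact: hB|exists z].
apply: contrapT => /forall2NP noz.
have lt_M z : K z -> phi z < M.
  move=> Kz; have [//|h] := noz z; case: ltgtP (hM _ Kz) => // E _.
  by case: h => w Kw; rewrite E; exact: hM.
have [] := @cov R (at_left M) (fun t z => phi z <= t) _.
  move=> z Kz; pose t0 := (phi z + M) / 2; have := lt_M _ Kz => h.
  exists ([set w | K w -> phi w < phi z + (t0 - phi z)], [set t | t0 < t]).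
    split; first by apply: usc => //; rewrite /t0; lra.
    by apply: nbhs_left_gt; rewrite /t0; lra.
  by move=> [w t] [/= hw ht] /hw; lra.
move=> e /= e0 he; pose t := M - e / 2.
have : M <= t; last by rewrite /t; lra.
apply: ge_sup; first by exists (phi z0); exists z0.
move=> _ [z Kz <-]; apply: (he t) => //; rewrite /t /=; last by lra.
by rewrite opprB addrC subrK gtr0_norm; lra.
Qed.

Lemma closed_bounded_level K (phi : C -> R) (m : R) : closed_bounded K ->
  (forall z e, K z -> 0 < e ->
     \forall w \near z, K w -> `|phi w - phi z| < e) ->
  closed_bounded (K `&` [set z | phi z = m]).
Proof.
move=> [Kc [a [l l0 Ka]]] hphi; split; last first.
  by exists a; exists l => // z [/Ka].
move=> z /not_andP[/Kc|]; first by apply: filterS => w nK [].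
have [Kz|/Kc nK _] := pselect (K z); last by apply: filterS nK => w nK [].
move=> /= zm; have e0 : 0 < `|phi z - m| by rewrite normr_gt0 subr_eq0; apply/eqP.
apply: filterS (hphi _ _ Kz e0) => w hw [Kw wm]; have := hw Kw.
by rewrite wm distrC ltxx.
Qed.

Lemma holo_modc_near K h z (e : R) : holomorphic_on K h -> K z -> 0 < e ->
  \forall w \near z, K w -> `|modc (h w) - modc (h z)| < e.
Proof.
move=> hh Kz e0; have [d d0 hd] := holo_near hh Kz e0.
apply/nbhs_modcP; exists d => // w wd Kw; apply: le_lt_trans (hd _ Kw wd).
have h1 := modcD (h w - h z) (h z); rewrite subrK in h1.
have h2 := modcD (h z - h w) (h w); rewrite subrK modcB in h2.
by rewrite ler_norml; apply/andP; split; lra.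
Qed.

Lemma closed_bounded_bottom a l : 0 < l -> closed_bounded (bottom_side a l).
Proof.
move=> l0; split; last first.
  by exists a; exists l => // z hz; apply: perimeter_sub; [lra|left; left; left].
move=> z nz; pose d := Num.max `|imc z - imc a|
    (Num.max (rec a - rec z) (rec z - (rec a + l))).
have d0 : 0 < d.
  rewrite ltNge; apply/negP; rewrite !ge_max normr_le0 subr_eq0.
  by move=> /and3P[/eqP h1 h2 h3]; apply: nz; split => //; apply/andP; split; lra.
apply/nbhs_modcP; exists d => // w wd [wi /andP[w1 w2]]; move: wd.
have := rec_le_modc (w - z); have := imc_le_modc (w - z).
rewrite recD recN imcD imcN wi !lt_max [`|imc a - _|]distrC => h1.
by rewrite ler_norml => /andP[h2 h3]; case/or3P; lra.
Qed.

(** Among the points of [K] where [|h|] is maximal, let [c] have the least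
    imaginary part. If a square around [c] fits in [K], then [|h|] stays
    below that maximum on the bottom side of the square, which contradicts
    [center_le_bottom]. *)
Theorem max_principle K h (m : R) : closed_bounded K -> holomorphic_on K h ->
  (forall z, K z -> (exists2 s, 0 < s & csquare z s `<=` K) \/ modc (h z) <= m) ->
  forall z, K z -> modc (h z) <= m.
Proof.
move=> cK hh inter z0 Kz0.
have [z1 Kz1 max1] : exists2 z, K z & forall w, K w -> modc (h w) <= modc (h z).
  apply: extreme_value => //; first by exists z0.
  move=> z e Kz e0; apply: filterS (holo_modc_near hh Kz e0) => w hw /hw.
  by rewrite ltr_norml => /andP[_]; lra.
apply: le_trans (max1 _ Kz0) _; rewrite leNgt; apply/negP => ltm.
set mx := modc (h z1) in max1 ltm.
pose E := K `&` [set z | modc (h z) = mx].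
have cE : closed_bounded E.
  by apply: closed_bounded_level => // z e; exact: holo_modc_near.
have [c [Kc hc] minc] : exists2 z, E z & forall w, E w -> - imc w <= - imc z.
  apply: extreme_value => //; first by exists z1.
  move=> z e _ e0; apply/nbhs_modcP; exists e => // w wd _.
  have := imc_le_modc (w - z); rewrite imcD imcN ler_norml => /andP[]; lra.
rewrite /= in hc; case: (inter c Kc) => [[s s0 sK]|]; last by rewrite hc leNgt ltm.
have hs : holomorphic_on (csquare c s) h by exact: holo_sub hh.
have l0 : 0 < 2 * s by lra.
pose T := bottom_side (c - cmk s s) (2 * s).
have TK z : T z -> K z.
  by move=> Tz; apply/sK/perimeter_sub; [lra|left; left; left].
have [w0 Tw0 maxT] : exists2 z, T z & forall w, T w -> modc (h w) <= modc (h z).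
  apply: extreme_value; first exact: closed_bounded_bottom.
    by have [[t _] _ _ _] := side_ends (c - cmk s s) (ltW l0); exists (c - cmk s s).
  move=> z e Tz e0; apply: filterS (holo_modc_near hh (TK _ Tz) e0) => w hw /TK/hw.
  by rewrite ltr_norml => /andP[_]; lra.
have lt0 : modc (h w0) < mx.
  rewrite lt_neqAle max1 ?andbT; last exact: TK.
  apply/eqP => E0; have := minc w0 (conj (TK _ Tw0) E0).
  by case: Tw0; rewrite imc_csq => -> _; lra.
have := @center_le_bottom _ h c s mx (modc (h w0)) s0 hs.
rewrite hc => H; have : mx ^+ 4 <= modc (h w0) * mx ^+ 3.
  apply: H; first by move=> z /sK/max1.
  move=> z [sz _] iz; apply: maxT; split; first by rewrite imc_csq.
  exact: sz.
rewrite exprS leNgt => /negP; apply; rewrite ltr_pM2r // exprn_gt0 //.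
by apply: le_lt_trans lt0; exact: modc_ge0.
Qed.

Definition disc u (r : R) : set C := [set z | modc (z - u) <= r].

Lemma csquare_sub_disc z s : 0 <= s -> csquare z s `<=` disc z (2 * s).
Proof.
move=> s0 w [/andP[w1 w2] /andP[w3 w4]]; rewrite /disc /=.
rewrite !rec_csq in w1 w2; rewrite !imc_csq in w3 w4.
apply: le_trans (modc_le_recim _) _; rewrite recD recN imcD imcN.
have : `|rec w - rec z| <= s by rewrite ler_norml; apply/andP; split; lra.
have : `|imc w - imc z| <= s by rewrite ler_norml; apply/andP; split; lra.
lra.
Qed.

Definition annulus u (r rho : R) : set C :=
  [set z | r <= modc (z - u) <= rho].

Lemma modc_dist_lip z w u : `|modc (w - u) - modc (z - u)| <= modc (w - z).
Proof.
have h1 := modcD (w - z) (z - u); rewrite addrA subrK in h1.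
have h2 := modcD (z - w) (w - u); rewrite addrA subrK [modc (z - w)]modcB in h2.
by rewrite ler_norml; apply/andP; split; lra.
Qed.

Lemma closed_bounded_annulus u r rho : 0 < rho -> closed_bounded (annulus u r rho).
Proof.
move=> r0; split; last first.
  exists (u - cmk rho rho); exists (2 * rho); first by lra.
  move=> z /andP[_ zr]; have h1 := rec_le_modc (z - u); have h2 := imc_le_modc (z - u).
  rewrite recD recN ler_norml in h1; rewrite imcD imcN ler_norml in h2.
  case/andP: h1 => *; case/andP: h2 => *.
  by split; rewrite ?rec_csq ?imc_csq; apply/andP; split; lra.
move=> z nz; pose d := Num.max (r - modc (z - u)) (modc (z - u) - rho).
have d0 : 0 < d.
  rewrite ltNge; apply/negP; rewrite !ge_max => /andP[h1 h2].
  by apply: nz; apply/andP; split; lra.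
apply/nbhs_modcP; exists d => // w wd /andP[w1 w2].
have := modc_dist_lip z w u; rewrite ler_norml => /andP[h1 h2].
by move: wd; rewrite lt_max => /orP[]; lra.
Qed.

Lemma annulus_max u r rho h (m : R) : 0 < r < rho ->
  holomorphic_on (annulus u r rho) h ->
  (forall z, modc (z - u) = r \/ modc (z - u) = rho -> modc (h z) <= m) ->
  forall z, annulus u r rho z -> modc (h z) <= m.
Proof.
move=> /andP[r0 rrho] hh bd; apply: max_principle => //.
  by apply: closed_bounded_annulus; lra.
move=> z /andP[]; rewrite le_eqVlt => /orP[/eqP zr _|z1].
  by right; apply: bd; left; rewrite zr.
rewrite le_eqVlt => /orP[/eqP z2|z2]; first by right; apply: bd; right.
left; pose s := Num.min (modc (z - u) - r) (rho - modc (z - u)) / 2.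
have s0 : 0 < s by rewrite divr_gt0 // lt_min; apply/andP; split; lra.
exists s => // w /(csquare_sub_disc (ltW s0)); rewrite /disc /= /s.
have -> : 2 * (Num.min (modc (z - u) - r) (rho - modc (z - u)) / 2) =
  Num.min (modc (z - u) - r) (rho - modc (z - u)) by field.
rewrite le_min => /andP[h1 h2].
have := modc_dist_lip z w u; rewrite ler_norml => /andP[h3 h4].
by apply/andP; split; lra.
Qed.

Lemma pow_between (S M t : R) : 0 < S -> S <= M -> 1 < t ->
  exists2 k, S * t ^+ k <= M & M < S * t ^+ k.+1.
Proof.
move=> S0 SM t1.
have ex : exists k, M < S * t ^+ k.
  exists (Num.truncn (M / S / (t - 1))).+1.
  rewrite mulrC -ltr_pdivrMr //; apply: lt_le_trans (bernoulli_le _ (ltW t1)).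
  have := truncnS_gt (M / S / (t - 1)); rewrite ltr_pdivrMr ?subr_gt0 //; lra.
case: (ex_minnP ex) => -[|k] hk mink; first by rewrite expr0 mulr1 ltNge SM in hk.
by exists k => //; rewrite leNgt; apply/negP => /mink; rewrite ltnn.
Qed.

(** Let [k] be the largest integer with [S * (rho / r) ^ k <= M]. The function
    [g z / (z - u) ^ k] is at most [M / rho ^ k] on both circles of the annulus,
    hence everywhere in it: [|g z| <= M * (3 / 4) ^ k] on the disc of radius
    [3 / 4 * rho]. The choice of [N] bounds the power [N + 1] of
    [(3 / 4) ^ k] by [(r / rho) ^ k], which is at most
    [(S / M) * (rho / r)] because [k] is largest. *)
Lemma three_circles_aux u r rho g (M S : R) N : 0 < r < rho -> 0 < S ->
  holomorphic_on (disc u rho) g ->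
  (forall z, disc u rho z -> modc (g z) <= M) ->
  (forall z, disc u r z -> modc (g z) <= S) ->
  (3 / 4) ^+ N.+1 <= r / rho ->
  forall z, disc u (3 / 4 * rho) z ->
    modc (g z) ^+ N.+1 <= M ^+ N * S * (rho / r).
Proof.
move=> /andP[r0 rrho] S0 hg gM gS hN z hz.
have rho0 : 0 < rho by lra.
have t1 : 1 < rho / r by rewrite ltr_pdivlMr // mul1r.
have zD : disc u rho z by move: hz; rewrite /disc /=; lra.
have M0 : 0 <= M by apply: le_trans (gM _ zD); exact: modc_ge0.
have easy (m : R) : modc (g z) <= m -> m <= S -> modc (g z) ^+ N.+1 <= M ^+ N * S * (rho / r).
  move=> gm mS; apply: (@le_trans _ _ (M ^+ N * S)).
    rewrite exprSr; apply: ler_pM; rewrite ?modc_ge0 ?exprn_ge0 ?modc_ge0 //; last by lra.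
    by apply: lerXn2r; rewrite ?nnegrE ?modc_ge0 ?gM.
  by rewrite ler_peMr ?mulr_ge0 ?exprn_ge0 // ltW.
have [zr|rz] := leP (modc (z - u)) r; first by apply: (easy S) => //; exact: gS.
(* If [M <= S] there may be no such [k], but the bound is trivial. *)
have [MS|SM] := leP M S; first by apply: (easy M) => //; exact: gM.
have [k hk1 hk2] := pow_between S0 (ltW SM) t1.
pose h w := g w * ((w - u) ^+ k)^-1.
have hh : holomorphic_on (annulus u r rho) h.
  apply: holoM; first by apply: holo_sub hg => w /andP[].
  apply: holoV; last by apply/holoX/holoD; [exact: holo_id|exact: holo_cst].
  move=> w /andP[w1 _]; apply: expf_neq0; rewrite -modc_gt0; lra.
have hm : modc (h z) <= M / rho ^+ k.
  apply: (annulus_max _ hh); [by rewrite r0| |by apply/andP; split => //; lra].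
  move=> w wb; rewrite modcM modcV modcX.
  case: wb => wE; rewrite wE.
    have := gS w; rewrite /disc /= wE lexx => /(_ isT) gw.
    apply: (@le_trans _ _ (S / r ^+ k)).
      by rewrite ler_wpM2r // invr_ge0 exprn_ge0 // ltW.
    by rewrite ler_pdivlMr ?exprn_gt0 // -mulrA [_^-1 * _]mulrC -expr_div_n.
  have := gM w; rewrite /disc /= wE lexx => /(_ isT) gw.
  by rewrite ler_wpM2r // invr_ge0 exprn_ge0 // ltW.
have gz : modc (g z) <= M * (3 / 4) ^+ k.
  have zu : 0 < modc (z - u) by lra.
  have -> : modc (g z) = modc (h z) * modc (z - u) ^+ k.
    by rewrite /h modcM modcV modcX divfK // expf_neq0 // gt_eqF.
  apply: le_trans (ler_pM _ _ hm (_ : _ <= (3 / 4 * rho) ^+ k)) _.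
  - exact: modc_ge0.
  - by rewrite exprn_ge0 ?modc_ge0.
  - by apply: lerXn2r; rewrite ?nnegrE ?modc_ge0 //; lra.
  - by rewrite exprMn mulrA mulrAC divfK // expf_neq0 // gt_eqF.
apply: (@le_trans _ _ ((M * (3 / 4) ^+ k) ^+ N.+1)).
  by apply: lerXn2r; rewrite ?nnegrE ?modc_ge0 ?mulr_ge0 ?exprn_ge0.
rewrite exprMn -exprM mulnC exprM.
apply: (@le_trans _ _ (M ^+ N.+1 * (r / rho) ^+ k)).
  apply: ler_wpM2l; first exact: exprn_ge0.
  by apply: lerXn2r; rewrite ?nnegrE ?exprn_ge0 // ?divr_ge0 // ltW.
rewrite exprSr -!mulrA; apply: ler_wpM2l; first exact: exprn_ge0.
rewrite -[r / rho]invf_div exprVn ler_pdivrMr ?exprn_gt0 ?divr_gt0 //.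
by rewrite -mulrA -exprS ltW.
Qed.

(** Hadamard's three circles theorem with a rational exponent [1 / (N + 1)] and
    a constant [rho / r], stated without logarithms or roots. The case [S = 0]
    follows from the case [S > 0] by a limit. *)
Theorem three_circles u r rho g (M S : R) N : 0 < r < rho -> 0 <= S ->
  holomorphic_on (disc u rho) g ->
  (forall z, disc u rho z -> modc (g z) <= M) ->
  (forall z, disc u r z -> modc (g z) <= S) ->
  (3 / 4) ^+ N.+1 <= r / rho ->
  forall z, disc u (3 / 4 * rho) z ->
    modc (g z) ^+ N.+1 <= M ^+ N * S * (rho / r).
Proof.
move=> rrho S0 hg gM gS hN z hz; have /andP[r0 r1] := rrho.
have M0 : 0 <= M.
  apply: (le_trans (modc_ge0 (g z))); apply: gM; move: hz; rewrite /disc /=; lra.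
have t0 : 0 < rho / r by rewrite divr_gt0 //; lra.
have A0 : 0 < M ^+ N * (rho / r) + 1 by rewrite ltr_wpDl // mulr_ge0 ?exprn_ge0 // ltW.
apply/ler_addgt0Pr => e e0.
pose e' := e / (M ^+ N * (rho / r) + 1); have e'0 : 0 < e' by rewrite divr_gt0.
have gS' w : disc u r w -> modc (g w) <= S + e' by move=> /gS; lra.
have S'0 : 0 < S + e' by lra.
apply: le_trans (three_circles_aux rrho S'0 hg gM gS' hN hz) _.
have -> : e = e' * (M ^+ N * (rho / r)) + e' by rewrite -[X in _ + X]mulr1 -mulrDr divfK // gt_eqF.
lra.
Qed.

End Compactness.

(** * Norms of sections and local lifts *)

Section Projective.
Variables (R : realType) (n : nat).
Local Notation C := (Cplx R).
Local Notation PnC := (proj_space R n).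
Local Notation homog P d := (P \is ishomog1 d (@mdeg _)).
Implicit Types (Z : 'rV[C]_n.+1) (x : PnC) (i : 'I_n.+1) (P : mpoly n.+1 C).

Lemma affine_open_pi i (Z : @nonzero_vectors R n) :
  affine_open i (\pi_(PnC) Z) <-> \val Z 0 i != 0.
Proof.
have [a a0 e] := homog_coord_pi Z.
by rewrite /affine_open /= e mxE mulf_eq0 (negbTE a0).
Qed.

(** The preimage of an affine chart among the nonzero vectors is given by the
    nonvanishing of a coordinate. *)
Lemma open_affine_open i : open (@affine_open R n i).
Proof.
rewrite /open /= /quotient_open.
have -> : \pi_(PnC) @^-1` affine_open i =
    (fun Z : @nonzero_vectors R n => \val Z 0 i) @^-1` [set z : C | z != 0].
  by apply/seteqP; split => Z /=; move/affine_open_pi.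
apply: open_comp.
  move=> Z _.
  apply: (@continuous_comp _ _ _ (fun Z : @nonzero_vectors R n => \val Z)
    (fun Z : 'rV[C]_n.+1 => Z 0 i)).
    exact: initial_continuous.
  exact: coord_continuous.
rewrite openE => z /= z0; apply/nbhs_modcP; exists (modc z); first by rewrite modc_gt0.
by move=> w; apply: contraTneq => ->; rewrite sub0r modcN ltxx.
Qed.

(** The representative of [x] whose [i]-th coordinate is 1, for [x] in the
    [i]-th affine chart. *)
Definition affine_vector i x : 'rV[C]_n.+1 := \row_j affine_coord i j x.

Lemma affine_vectorE i x : affine_vector i x = (homog_coord x 0 i)^-1 *: homog_coord x.
Proof. by apply/rowP => j; rewrite !mxE mulrC. Qed.

Lemma section_norm_ge0 d P x : 0 <= section_norm d P x.
Proof. by rewrite divr_ge0 ?modc_ge0 // exprn_ge0 // sqrtr_ge0. Qed.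

Lemma section_norm_affine d P x i : homog P d -> affine_open i x ->
  section_norm d P x =
  modc (hpoly_eval P (affine_vector i x)) / hnorm (affine_vector i x) ^+ d.
Proof.
move=> hP; rewrite /affine_open /= => xi.
rewrite affine_vectorE (hpoly_evalZ _ _ hP) hnormZ modcM modcX exprMn /section_norm.
have a0 : modc (homog_coord x 0 i)^-1 != 0 by rewrite modc_eq0 invr_eq0.
by rewrite invfM mulrACA divff ?mul1r // expf_neq0.
Qed.

Lemma modc_le_hnorm Z i : modc (Z 0 i) <= hnorm Z.
Proof.
rewrite /hnorm -[leLHS]ger0_norm ?modc_ge0 // -sqrtr_sqr ler_wsqrtr //.
by rewrite (bigD1 i) //= lerDl sumr_ge0 // => j _; rewrite sqr_ge0.
Qed.

Lemma hnorm_le_sum Z : hnorm Z <= \sum_i modc (Z 0 i).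
Proof.
have s0 : 0 <= \sum_i modc (Z 0 i) by rewrite sumr_ge0 // => i _; exact: modc_ge0.
rewrite /hnorm -[leRHS]ger0_norm // -sqrtr_sqr ler_wsqrtr //.
rewrite expr2 mulr_sumr ler_sum // => i _; rewrite expr2 ler_wpM2r ?modc_ge0 //.
by rewrite (bigD1 i) //= lerDl sumr_ge0 // => j _; exact: modc_ge0.
Qed.

Lemma modc_sum (I : Type) (s : seq I) (F : I -> C) :
  modc (\sum_(i <- s) F i) <= \sum_(i <- s) modc (F i).
Proof.
elim: s => [|i s IH]; first by rewrite !big_nil modc0.
by rewrite !big_cons; apply: le_trans (modcD _ _) _; rewrite lerD2l.
Qed.

Lemma modc_prod (I : Type) (s : seq I) (F : I -> C) :
  modc (\prod_(i <- s) F i) = \prod_(i <- s) modc (F i).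
Proof.
elim: s => [|i s IH]; first by rewrite !big_nil modc1.
by rewrite !big_cons modcM IH.
Qed.

(** Each monomial of degree [d] is at most [hnorm Z ^ d] in modulus. *)
Lemma section_norm_bounded d P : homog P d ->
  exists B, forall x, section_norm d P x <= B.
Proof.
move=> hP; exists (\sum_(m <- msupp P) modc (mcoeff m P)) => x.
set Z := homog_coord x.
have [i Zi] : exists i, Z 0 i != 0.
  apply/existsP; rewrite -negb_forall; apply/negP => /forallP Z0.
  have /negP := homog_coord_neq0 x; apply; apply/eqP/rowP => i.
  by rewrite mxE; apply/eqP; exact: Z0.
have h0 : 0 < hnorm Z by apply: lt_le_trans (modc_le_hnorm Z i); rewrite modc_gt0.
rewrite /section_norm -/Z ler_pdivrMr ?exprn_gt0 // /hpoly_eval mevalE.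
apply: le_trans (modc_sum _ _) _; rewrite mulr_suml big_seq [leRHS]big_seq.
move/dhomogP: hP => hP; apply: ler_sum => m /hP mE.
have {mE}<- : mdeg m = d := mE.
rewrite modcM ler_wpM2l ?modc_ge0 // modc_prod mdegE -prodrXr.
apply: ler_prod => j _; rewrite modc_ge0 modcX /=.
by apply: lerXn2r; rewrite ?nnegrE ?modc_ge0 ?modc_le_hnorm // ltW.
Qed.

Lemma holo_hpoly_eval (A : set C) (F : C -> 'rV[C]_n.+1) P :
  (forall j, holomorphic_on A (fun z => F z 0 j)) ->
  holomorphic_on A (fun z => hpoly_eval P (F z)).
Proof.
move=> hF; apply: (@holo_ext _ _ (fun z => \sum_(m <- msupp P)
   mcoeff m P * \prod_(i < n.+1) F z 0 i ^+ m i)).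
  by move=> z _; rewrite /hpoly_eval mevalE.
apply: holo_sum => m; apply: holoM; first exact: holo_cst.
apply: (@holo_prod _ _ _ _ (fun j z => F z 0 j ^+ m j)) => j; exact: holoX (hF j).
Qed.

Section Chart.
Variables (V : bordered_riemann_surface R) (f : V -> PnC).
Variable (c : chart (@closed_upper_half_plane R) V).

Lemma chart_nbhs (p : V) (e : R) : chart_dom c p -> 0 < e ->
  \forall q \near p, chart_dom c q /\
    modc (chart_map c q - chart_map c p) < e.
Proof.
move=> dp e0; have oc := chart_dom_open c.
have := @chart_map_continuous _ _ _ c; rewrite continuous_open_subspace // => cc.
have hp : nbhs p (chart_dom c) by apply: open_nbhs_nbhs; split.
have : nbhs (chart_map c p) [set w | modc (w - chart_map c p) < e].
  by apply/nbhs_modcP; exists e.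
by move=> /(cc p (mem_set dp)) H; near=> q; split; near: q.
Unshelve. all: by end_near. Qed.

Lemma chart_inv_near (z : C) (A : set V) : chart_cod c z ->
  nbhs (chart_inv c z) A -> exists2 e : R, 0 < e &
    forall w, chart_cod c w -> modc (w - z) < e -> A (chart_inv c w).
Proof.
move=> cz hA; have /subspace_continuousP H := @chart_inv_continuous _ _ _ c.
have /nbhs_modcP[e e0 he] := H z cz _ hA.
by exists e => // w cw /he; apply.
Qed.

Lemma chart_half_plane (z : C) : chart_cod c z -> 0 <= imc z.
Proof. by have [U _ E] := chart_cod_open c; rewrite E => -[]. Qed.

Lemma chart_cod_near (z : C) : chart_cod c z -> exists2 e : R, 0 < e &
  forall w, 0 <= imc w -> modc (w - z) < e -> chart_cod c w.
Proof.
have [U oU E] := chart_cod_open c; rewrite E => -[Uz _].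
have : nbhs z U by apply: open_nbhs_nbhs; split.
by move=> /nbhs_modcP[e e0 he]; exists e => // w w0 /he.
Qed.

Definition half_disc (z : C) (r : R) : set C :=
  disc z r `&` @closed_upper_half_plane R.

(** The lift of [f] is its affine vector in an affine chart containing [f p].
    Its norm is at least 1, because one of its coordinates is 1, and at most [L]
    by continuity. The constants [r] and [L] do not depend on the section; this
    uniformity is what makes the constant of the hull have the form [K ^ d]. *)
Lemma local_section (p : V) : surface_atlas c -> holomorphic_to_proj f ->
  chart_dom c p -> exists r L : R, [/\ 0 < r, 1 <= L,
    half_disc (chart_map c p) r `<=` chart_cod c &
    forall d P, homog P d -> exists2 g : C -> C,
      holomorphic_on (half_disc (chart_map c p) r) g &
      forall z, half_disc (chart_map c p) r z ->
        section_norm d P (f (chart_inv c z)) <= modc (g z) /\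
        modc (g z) <= L ^+ d * section_norm d P (f (chart_inv c z))].
Proof.
move=> hc [cf hf] dp; set z0 := chart_map c p.
have cz0 : chart_cod c z0 by apply: chart_map_fun.
have [e1 e10 he1] := chart_cod_near cz0.
have [i xi] : exists i, affine_open i (f p).
  apply/existsP; rewrite -negb_forall; apply/negP => /forallP Z0.
  have /negP := homog_coord_neq0 (f p); apply; apply/eqP/rowP => i.
  by rewrite mxE; apply/eqP; exact: Z0.
have fz0 : chart_inv c z0 = p by apply: chart_mapK; rewrite inE.
have [e2 e20 he2] : exists2 e : R, 0 < e & forall w, chart_cod c w ->
    modc (w - z0) < e -> affine_open i (f (chart_inv c w)).
  apply: (@chart_inv_near z0 (f @^-1` affine_open i) cz0); rewrite fz0; apply: cf.
  by apply: open_nbhs_nbhs; split; [exact: open_affine_open|].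
pose F z := affine_vector i (f (chart_inv c z)).
pose A := chart_map c @` (chart_dom c `&` f @^-1` affine_open i).
have hF j : holomorphic_on A (fun z => F z 0 j).
  apply: holo_ext (hf c i j hc) => z _; by rewrite /F mxE.
have Ain z : chart_cod c z -> affine_open i (f (chart_inv c z)) -> A z.
  move=> cz fz; exists (chart_inv c z); last by apply: chart_invK; rewrite inE.
  by split => //; exact: chart_inv_fun.
have Az0 : A z0 by apply: Ain => //; rewrite fz0.
have : \forall w \near z0, forall j, A w -> modc (F w 0 j) <= modc (F z0 0 j) + 1.
  apply: (@filter_forall _ _ (fun j w => A w ->
    modc (F w 0 j) <= modc (F z0 0 j) + 1) _ (nbhs_filter z0)) => j.
  have [d d0 hd] := holo_near (hF j) Az0 ltr01.
  apply/nbhs_modcP; exists d => // w wd Aw; have := hd _ Aw wd.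
  by have := modcD (F w 0 j - F z0 0 j) (F z0 0 j); rewrite subrK; lra.
move=> /nbhs_modcP[e3 e30 he3].
pose r := Num.min e1 (Num.min e2 e3) / 2.
have m0 : 0 < Num.min e1 (Num.min e2 e3) by rewrite !lt_min e10 e20.
have hr w : half_disc z0 r w -> [/\ chart_cod c w,
    affine_open i (f (chart_inv c w)) & forall j, modc (F w 0 j) <= modc (F z0 0 j) + 1].
  move=> [wr wi]; have wm : modc (w - z0) < Num.min e1 (Num.min e2 e3).
    by apply: le_lt_trans wr _; rewrite /r; lra.
  move: wm; rewrite !lt_min => /and3P[w1 w2 w3].
  have cw := he1 w wi w1; have fw := he2 w cw w2.
  by split => // j; apply: he3 => //; exact: Ain.
exists r, (\sum_j (modc (F z0 0 j) + 1)); split.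
- by rewrite divr_gt0.
- rewrite (bigD1 i) //=.
  have h1 : 0 <= \sum_(j | j != i) (modc (F z0 0 j) + 1).
    by apply: sumr_ge0 => j _; rewrite addr_ge0 ?modc_ge0.
  have := modc_ge0 (F z0 0 i); lra.
- by move=> w /hr[].
move=> d P hP; exists (fun z => hpoly_eval P (F z)).
  apply: holo_hpoly_eval => j; apply: holo_sub (hF j) => w /hr[? ? _]; exact: Ain.
move=> z /hr[cz fz Fz]; rewrite (section_norm_affine hP fz) -/(F z).
have F1 : 1 <= hnorm (F z).
  have := modc_le_hnorm (F z) i; rewrite mxE /affine_coord divff ?modc1 //.
have FL : hnorm (F z) <= \sum_j (modc (F z0 0 j) + 1).
  by apply: le_trans (hnorm_le_sum _) _; apply: ler_sum => j _; exact: Fz.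
have F0 : 0 < hnorm (F z) by lra.
split.
  by rewrite ler_pdivrMr ?exprn_gt0 // ler_peMr ?modc_ge0 // exprn_ege1.
rewrite mulrCA ler_peMr ?modc_ge0 // ler_pdivlMr ?exprn_gt0 // mul1r.
by apply: lerXn2r; rewrite ?nnegrE // ltW // (lt_le_trans F0).
Qed.

End Chart.
End Projective.

(** * Propagation of the inequality over the surface *)

Section Hull.
Variables (R : realType) (n : nat).
Local Notation C := (Cplx R).
Local Notation PnC := (proj_space R n).
Local Notation homog P d := (P \is ishomog1 d (@mdeg _)).
Variables (V : bordered_riemann_surface R) (f : V -> PnC).
Implicit Types (p q : V) (c : chart (@closed_upper_half_plane R) V).

Definition sup_boundary d (P : mpoly n.+1 C) : R :=
  sup (section_norm d P @` (f @` surface_boundary V)).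

(** [M] ranges over all bounds of the norm of the section: the local estimates
    work with a fixed bound, and the supremum is substituted only at the
    end. *)
Definition interpolated (N : nat) (K : R) (q : V) : Prop :=
  forall d (P : mpoly n.+1 C) (M : R), (0 < d)%N -> homog P d ->
    (forall q', section_norm d P (f q') <= M) ->
    section_norm d P (f q) ^+ N.+1 <= K ^+ d * (M ^+ N * sup_boundary d P).

(** The inequality is required near [q] with constants that work at all the
    nearby points, so that [good] is open by definition and the constants can be
    made uniform by compactness. *)
Definition good : set V :=
  [set q | exists N K, 1 <= K /\ \forall q' \near q, interpolated N K q'].

Lemma le_sup_boundary d P q : homog P d -> surface_boundary V q ->
  section_norm d P (f q) <= sup_boundary d P.
Proof.
move=> hP bq; apply: ub_le_sup; last by exists (f q) => //; exists q.
by have [B hB] := section_norm_bounded hP; exists B => _ [x _ <-].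
Qed.

Hypothesis bdry : surface_boundary V !=set0.

Lemma sup_boundary_ge0 d P : homog P d -> 0 <= sup_boundary d P.
Proof.
move=> hP; have [q bq] := bdry.
by apply: le_trans (le_sup_boundary hP bq); exact: section_norm_ge0.
Qed.

(** The norm of the section is at most [M], so that both sides can be
    multiplied by a power of [M]. *)
Lemma interpolated_weaken N N' (K K' : R) q : (N <= N')%N -> 1 <= K <= K' ->
  interpolated N K q -> interpolated N' K' q.
Proof.
move=> NN /andP[K1 KK] H d P M d0 hP hM.
have s0 : 0 <= section_norm d P (f q) := section_norm_ge0 _ _ _.
have M0 : 0 <= M by apply: le_trans (hM q).
have S0 := sup_boundary_ge0 hP.
have -> : N'.+1 = (N.+1 + (N' - N))%N by rewrite addSn subnKC.
rewrite exprD.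
have -> : M ^+ N' = M ^+ N * M ^+ (N' - N) by rewrite -exprD subnKC.
apply: (@le_trans _ _ (K ^+ d * (M ^+ N * sup_boundary d P) * M ^+ (N' - N))).
  apply: ler_pM; rewrite ?exprn_ge0 //; first exact: H.
  by apply: lerXn2r; rewrite ?nnegrE.
have -> : K' ^+ d * (M ^+ N * M ^+ (N' - N) * sup_boundary d P) =
  K' ^+ d * (M ^+ N * sup_boundary d P) * M ^+ (N' - N) by ring.
rewrite ler_wpM2r ?exprn_ge0 // ler_wpM2r ?mulr_ge0 ?exprn_ge0 //.
by apply: lerXn2r; rewrite ?nnegrE; lra.
Qed.

Hypothesis hf : holomorphic_to_proj f.

(** In a chart with values in the closed half plane, the square around [z] with
    half side [Im z] has its bottom side in the image of the boundary of
    [V]. *)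
Lemma boundary_good : surface_boundary V `<=` good.
Proof.
move=> p [c [hc dp ip]].
have [r [L [r0 L1 Ecod loc]]] := local_section hc hf dp.
set z0 := chart_map c p in Ecod loc ip.
exists 3%N, (L ^+ 4); split; first exact: exprn_ege1.
have r4 : 0 < r / 4 by rewrite divr_gt0.
apply: filterS (chart_nbhs dp r4) => q [dq qz] d P M d0 hP hM.
have [g hg hgs] := loc d P hP.
set z := chart_map c q in qz; set S := sup_boundary d P.
have S0 : 0 <= S := sup_boundary_ge0 hP.
have M0 : 0 <= M := le_trans (section_norm_ge0 _ _ _) (hM q).
have cz : chart_cod c z by exact: chart_map_fun.
have iz : chart_inv c z = q by apply: chart_mapK; rewrite inE.
have Ez : half_disc z0 r z.
  by split; [rewrite /disc /=; lra|exact: chart_half_plane cz].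
have Ld : 1 <= L ^+ d by exact: exprn_ege1.
have bdS w : half_disc z0 r w -> imc w = 0 -> modc (g w) <= L ^+ d * S.
  move=> Ew w0; have [_ /le_trans] := hgs w Ew; apply.
  rewrite ler_wpM2l ?exprn_ge0 //; first by lra.
  apply: le_sup_boundary => //; exists c; split => //.
    exact: chart_inv_fun (Ecod _ Ew).
  by rewrite chart_invK // inE; exact: Ecod.
have bdM w : half_disc z0 r w -> modc (g w) <= L ^+ d * M.
  move=> Ew; have [_ /le_trans] := hgs w Ew; apply.
  by rewrite ler_wpM2l ?exprn_ge0 //; lra.
have [sz _] := hgs z Ez; rewrite iz in sz.
have E4 : (L ^+ 4) ^+ d * (M ^+ 3 * S) = L ^+ d * S * (L ^+ d * M) ^+ 3.
  by rewrite -exprM mulnC exprM; ring.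
rewrite E4; apply: (@le_trans _ _ (modc (g z) ^+ 4)).
  by apply: lerXn2r; rewrite ?nnegrE ?section_norm_ge0 ?modc_ge0.
(* If [z] is itself on the real line the square degenerates. *)
have := chart_half_plane cz; rewrite le_eqVlt => /orP[/eqP z0'|t0].
  rewrite exprS; apply: ler_pM; rewrite ?exprn_ge0 ?modc_ge0 //.
    exact: bdS.
  by apply: lerXn2r; rewrite ?nnegrE ?modc_ge0 ?mulr_ge0 ?exprn_ge0 ?bdM //; lra.
have tle : imc z <= modc (z - z0).
  have := imc_le_modc (z - z0); rewrite imcD imcN ip oppr0 addr0.
  exact: le_trans (ler_norm _).
have sqE : csquare z (imc z) `<=` half_disc z0 r.
  move=> w sw; split; last first.
    by case: sw => _ /andP[]; rewrite imc_csq subrr.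
  have := csquare_sub_disc (ltW t0) sw; rewrite /disc /=.
  have := modcD (w - z) (z - z0); rewrite addrA subrK; lra.
apply: (@center_le_bottom _ g z (imc z)) => //.
- exact: holo_sub hg.
- by move=> w /sqE/bdM.
- by move=> w /sqE Ew; rewrite subrr; exact: bdS.
Qed.

Lemma exists_expn_le (x : R) : 0 < x -> exists N, (3 / 4) ^+ N.+1 <= x.
Proof.
move=> x0; pose N := Num.truncn (3 / x); exists N.
have h := truncnS_gt (3 / x); rewrite -/N ltr_pdivrMr // in h.
have t1 : 1 <= 4 / 3 :> R by lra.
have b := bernoulli_le N.+1 t1.
have -> : 3 / 4 = (4 / 3)^-1 :> R by rewrite invf_div.
have p0 : 0 < (4 / 3) ^+ N.+1 :> R by rewrite exprn_gt0 //; lra.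
rewrite exprVn -[leLHS]mul1r ler_pdivrMr //.
have : 1 + N.+1%:R * (4 / 3 - 1) <= (4 / 3) ^+ N.+1 :> R := b.
have : x * (1 + N.+1%:R * (4 / 3 - 1)) <= x * (4 / 3) ^+ N.+1 by rewrite ler_pM2l.
lra.
Qed.

(** Let [p] be a limit of [good] points, in a chart where it is interior, and
    let [u] be the coordinate of a [good] point so close to [p] that the disc of
    radius [rho] around [u] is still in the chart and a neighborhood of [p] lies
    in the disc of radius [3 / 4 * rho]. The inequality with exponent [N0 + 1]
    holds on a small disc around [u], and the three circles theorem for
    [g ^ (N0 + 1)] carries it to the neighborhood of [p]. *)
Lemma good_closed : closure good `<=` good.
Proof.
move=> p clp; have [c hc dp] := surface_cover p.
have cz0 : chart_cod c (chart_map c p) by exact: chart_map_fun.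
have := chart_half_plane cz0; rewrite le_eqVlt => /orP[/eqP i0|i0].
  by apply: boundary_good; exists c.
have [r [L [r0 L1 Ecod loc]]] := local_section hc hf dp.
set z0 := chart_map c p in cz0 i0 Ecod loc.
(* The full disc of radius [r1] around [z0] stays in the half plane. *)
pose r1 := Num.min r (imc z0).
have r10 : 0 < r1 by rewrite lt_min r0.
have discE w : modc (w - z0) <= r1 -> half_disc z0 r w.
  rewrite le_min => /andP[w1 w2]; split => //.
  have := imc_le_modc (w - z0); rewrite imcD imcN ler_norml => /andP[h _].
  rewrite /closed_upper_half_plane /=; lra.
have r14 : 0 < r1 / 4 by lra.
have [q0 [[N0 [K0 [K01 q0N]]] [dq0 q0z]]] := clp _ (chart_nbhs dp r14).
set u := chart_map c q0 in q0z.
have cu : chart_cod c u by exact: chart_map_fun.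
have iu : chart_inv c u = q0 by apply: chart_mapK; rewrite inE.
rewrite -iu in q0N; have [e e0 he] := chart_inv_near cu q0N.
pose rho := r1 / 2; pose s := Num.min (e / 2) (rho / 2).
have rho0 : 0 < rho by rewrite /rho; lra.
have s0 : 0 < s by rewrite lt_min; apply/andP; split; lra.
have srho : s < rho by rewrite /s gt_min; apply/orP; right; lra.
have [N1 hN1] := exists_expn_le (divr_gt0 s0 rho0).
pose t := rho / s; have t1 : 1 <= t by rewrite ler_pdivlMr // mul1r ltW.
exists (N0.+1 * N1 + N0)%N, (L ^+ (N0.+1 * N1.+1) * K0 * t); split.
  by apply: mulr_ege1 => //; apply: mulr_ege1 => //; exact: exprn_ege1.
have r18 : 0 < r1 / 8 by lra.
apply: filterS (chart_nbhs dp r18) => q [dq qz] d P M d0 hP hM.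
have [g hg hgs] := loc d P hP.
set z := chart_map c q in qz; set S := sup_boundary d P.
have S0 : 0 <= S := sup_boundary_ge0 hP.
have M0 : 0 <= M := le_trans (section_norm_ge0 _ _ _) (hM q).
have cz : chart_cod c z by exact: chart_map_fun.
have iz : chart_inv c z = q by apply: chart_mapK; rewrite inE.
have Ld : 1 <= L ^+ d by exact: exprn_ege1.
have Ld0 : 0 <= L ^+ d by lra.
have Dsub : disc u rho `<=` half_disc z0 r.
  move=> w; rewrite /disc /= /rho => wu; apply: discE.
  have := modcD (w - u) (u - z0); rewrite addrA subrK; lra.
have uz : disc u (3 / 4 * rho) z.
  have := modcD (z - z0) (z0 - u); rewrite addrA subrK [modc (z0 - u)]modcB.
  rewrite /disc /= /rho; lra.
have uz1 : disc u rho z by move: uz; rewrite /disc /=; lra.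
have [sz _] := hgs z (Dsub _ uz1); rewrite iz in sz.
have LM0 : 0 <= L ^+ d * M by rewrite mulr_ge0 //; lra.
pose M' := (L ^+ d * M) ^+ N0.+1.
pose S' := (L ^+ d) ^+ N0.+1 * (K0 ^+ d * (M ^+ N0 * S)).
have K0d : 1 <= K0 ^+ d by exact: exprn_ege1.
have three : modc (g z ^+ N0.+1) ^+ N1.+1 <= M' ^+ N1 * S' * t.
  apply: (@three_circles _ u s rho (fun w => g w ^+ N0.+1)) => //.
  - by rewrite s0.
  - by rewrite !mulr_ge0 ?exprn_ge0 //; lra.
  - by apply/holoX/(holo_sub Dsub).
  - move=> w /Dsub Ew; rewrite modcX; apply: lerXn2r; rewrite ?nnegrE ?modc_ge0 //.
    have [_ /le_trans] := hgs w Ew; apply.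
    by rewrite ler_wpM2l //; lra.
  - move=> w ws; have ww : disc u rho w by move: ws; rewrite /disc /=; lra.
    have [_ gw] := hgs w (Dsub _ ww); rewrite modcX.
    have we : modc (w - u) < e.
      by move: ws; rewrite /disc /= le_min => /andP[]; lra.
    have := he w (Ecod _ (Dsub _ ww)) we d P M d0 hP hM => sw.
    apply: (@le_trans _ _ ((L ^+ d * section_norm d P (f (chart_inv c w))) ^+ N0.+1)).
      apply: lerXn2r gw; rewrite nnegrE ?modc_ge0 //.
      by apply: mulr_ge0 => //; exact: section_norm_ge0.
    by rewrite exprMn ler_wpM2l // exprn_ge0 //; lra.
apply: (@le_trans _ _ (M' ^+ N1 * S' * t)).
  apply: le_trans three; rewrite modcX -exprM.
  have -> : (N0.+1 * N1 + N0).+1 = (N0.+1 * N1.+1)%N by rewrite mulnS -addnS addnC.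
  by apply: lerXn2r; rewrite ?nnegrE ?section_norm_ge0 ?modc_ge0.
have -> : (L ^+ (N0.+1 * N1.+1) * K0 * t) ^+ d * (M ^+ (N0.+1 * N1 + N0) * S) =
    M' ^+ N1 * S' * t ^+ d.
  rewrite /M' /S' !exprMn -!exprM [(N0.+1 * N1.+1 * d)%N]mulnC mulnS mulnDr !exprD mulnA.
  ring.
rewrite ler_wpM2l ?mulr_ge0 ?exprn_ge0 //; try lra.
by rewrite -(prednK d0) exprS ler_peMr ?exprn_ege1 //; lra.
Qed.

Hypothesis cV : compact [set: V].
Hypothesis conV : connected [set: V].

Lemma good_open : open good.
Proof.
rewrite openE => q [N [K [K1 hq]]]; apply: filterS (nbhs_interior hq) => q' hq'.
by exists N, K.
Qed.

Lemma interpolated_everywhere : good = [set: V].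
Proof.
apply: conV.
- by have [q bq] := bdry; exists q; exact: boundary_good.
- by exists good; [exact: good_open|rewrite setTI].
- by exists good; [exact: good_closed|rewrite setTI].
Qed.

Lemma interpolated_uniform : exists N (K : R), 1 <= K /\ forall q, interpolated N K q.
Proof.
have /compact_near_coveringP cov := cV.
have [|N _ hN] := cov nat \oo (fun m q => interpolated m m.+1%:R q) _.
  move=> q _; have [N [K [K1 hq]]] : good q by rewrite interpolated_everywhere.
  exists (interpolated N K, [set m | (maxn N (Num.truncn K) <= m)%N]).
    by split => //=; exists (maxn N (Num.truncn K)).
  move=> [q' m] [/= hq' hm]; move: hm; rewrite geq_max => /andP[Nm Km].
  apply: interpolated_weaken hq' => //; rewrite K1 /=.
  by apply: le_trans (ltW (truncnS_gt K)) _; rewrite ler_nat.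
exists N, N.+1%:R; split; first by rewrite ler1n.
by move=> q; apply: (hN N) => //=.
Qed.

(** If the supremum [M] is positive, the [(N + 1)]-th root of the right-hand
    side is an upper bound of [phi], hence at least [M]; the factor [M ^ N] then
    cancels. *)
Lemma le_of_sup_interpolation (K S : R) N (phi : V -> R) (p : V) :
  (forall q, 0 <= phi q) -> has_ubound (range phi) -> 0 <= K -> 0 <= S ->
  (forall M, (forall q, phi q <= M) ->
     forall q, phi q ^+ N.+1 <= K * (M ^+ N * S)) ->
  phi p <= K * S.
Proof.
move=> phi0 ub K0 S0 H; pose M := sup (range phi).
have hM q : phi q <= M by apply: ub_le_sup => //; exists q.
apply: le_trans (hM p) _.
have : 0 <= M by apply: le_trans (phi0 p) (hM p).
rewrite le_eqVlt => /orP[/eqP <-|M0]; first by rewrite mulr_ge0.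
pose T := K * (M ^+ N * S).
have T0 : 0 <= T by rewrite !mulr_ge0 ?exprn_ge0 // ltW.
pose x := T `^ (N.+1%:R)^-1.
have xT : x ^+ N.+1 = T.
  by rewrite -powR_mulrn ?powR_ge0 // /x -powRrM mulVf ?powRr1 // pnatr_eq0.
have Mx : M <= x.
  apply: ge_sup; first by exists (phi p); exists p.
  move=> _ [q _ <-]; rewrite -(@ler_pXn2r _ N.+1) ?nnegrE ?powR_ge0 //.
  by rewrite xT; exact: H.
have : M ^+ N.+1 <= T by rewrite -xT; apply: lerXn2r; rewrite ?nnegrE ?powR_ge0 // ltW.
by rewrite /T mulrCA exprSr ler_pM2l // exprn_gt0.
Qed.

End Hull.

Theorem proposition2p3 (R : realType) (n : nat)
    (V : bordered_riemann_surface R) (f : V -> proj_space R n) :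
  compact [set: V] -> connected [set: V] -> surface_boundary V !=set0 ->
  holomorphic_to_proj f -> extends_across_boundary f ->
  range f `<=` projective_hull (f @` surface_boundary V).
Proof.
move=> cV conV bdry hf _ _ [p _ <-].
have [N [K [K1 hK]]] := interpolated_uniform bdry hf cV conV.
exists K; first by lra.
move=> d P d0 hP.
apply: (@le_of_sup_interpolation _ V (K ^+ d) (sup_boundary f d P) N
  (fun q => section_norm d P (f q)) p).
- by move=> q; exact: section_norm_ge0.
- by have [B hB] := section_norm_bounded hP; exists B => _ [q _ <-].
- by rewrite exprn_ge0 //; lra.
- exact: sup_boundary_ge0.
- by move=> M hM q; exact: hK.
Qed.
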